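(* Let $f,g$ satisfy the standing assumptions below, let $\beta\ge\frac{4Q_gM_f}{\mu^3}$ and $\hat\beta\ge\beta\max\{\frac{8L_g^2}{\mu},\frac1{4\mu},\frac\mu4\}$. Consider Algorithm 2: from $(x_0,y_0)$, for $k=0,1,\dots$: compute $w_k$ with $\|\nabla^2_{yy}g(x_k,y_k)w_k-\nabla_yg(x_k,y_k)\|\le\varepsilon_{1,k}$; choose $(d_{x,k},d_{y,k})\in\mathcal{D}_f(x_k,y_k-w_k)$; compute $v_k$ with $\|\nabla^2_{yy}g(x_k,y_k)v_k-d_{y,k}\|\le\varepsilon_{2,k}$; set $x_{k+1}=x_k-\eta_k(d_{x,k}-\nabla^2_{xy}g(x_k,y_k)v_k)$ and $y_{k+1}=y_k-\eta_k\hat\beta\nabla_yg(x_k,y_k)$. Suppose: (a) $\sup_k\|x_k\|+\|y_k\|<\infty$; (b) $\eta_k\ge0$, $\sum_k\eta_k=\infty$, $\sum_k\eta_k^2<\infty$; (c) the set $\{f(x,y):(x,y)\text{ is a }\mathcal{D}_f\text{-stationary point of (BLO)}\}$ has empty interior; and $\lim_k\varepsilon_{1,k}=0$, $\sum_k\varepsilon_{2,k}\eta_k<\infty$. Then every limit point of $\{(x_k,y_k)\}$ is a $\mathcal{D}_f$-stationary point of (BLO), and $\{h(x_k,y_k)\}$ converges.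
   Context: Standing assumptions. (A1) Constants $M_f,\mu,L_g,Q_g>0$ exist such that: $f:\mathbb{R}^n\times\mathbb{R}^p\to\mathbb{R}$ is $M_f$-Lipschitz; $g$ is twice differentiable with $\nabla^2_{yy}g\succeq\mu I_p$; $\nabla g$ is $L_g$-Lipschitz; $\nabla^2_{yy}g,\nabla^2_{xy}g$ are $Q_g$-Lipschitz; $\nabla^2_{yy}g$ is continuously differentiable ($\nabla^2_{xy}g\in\mathbb{R}^{n\times p}$ has entries $\partial^2g/\partial x_i\partial y_j$). (A2) $f$ is a potential function of a conservative field $\mathcal{D}_f$ with compact convex values of norm at most $M_f$ (conservative field: closed graph, nonempty compact values, $\int_0^1\max_{v\in\mathcal{D}(\gamma(t))}\langle\gamma'(t),v\rangle dt=0$ along every absolutely continuous loop; potential: $f(\gamma(1))-f(\gamma(0))$ equals this integral along any absolutely continuous curve). Notation: $\mathcal{A}(x,y):=y-\nabla^2_{yy}g(x,y)^{-1}\nabla_yg(x,y)$, $h(x,y):=f(x,\mathcal{A}(x,y))+\frac\beta2\|\nabla_yg(x,y)\|^2$. $(x,y)$ is a $\mathcal{D}_f$-stationary point of (BLO) (the problem $\min f(x,y)$ s.t. $y=\arg\min_{y'}g(x,y')$) if there is $(d_x,d_y)\in\mathcal{D}_f(x,y)$ with $d_x-\nabla^2_{xy}g(x,y)\nabla^2_{yy}g(x,y)^{-1}d_y=0$ and $\nabla_yg(x,y)=0$. *)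

(* Defs.v *)
(* mathcomp-analysis over an abstract R : realType.
   Vectors of R^m are column vectors 'cV[R]_m; R^n x R^p is 'cV[R]_(n+p)
   (x = usubmx z, y = dsubmx z, (x,y) = col_mx x y). *)
From HB Require Import structures.
From mathcomp Require Import all_boot all_order all_algebra.
From mathcomp Require Import all_classical all_reals all_analysis.
Set Implicit Arguments. Unset Strict Implicit. Unset Printing Implicit Defensive.
Import Order.TTheory GRing.Theory Num.Theory.
Import numFieldNormedType.Exports.
Local Open Scope classical_set_scope.
Local Open Scope ring_scope.

Section Defs.
Variable R : realType.

Definition dot (m : nat) (u v : 'cV[R]_m) : R := \sum_i u i 0 * v i 0.
Definition enorm (m : nat) (u : 'cV[R]_m) : R := Num.sqrt (dot u u).

Definition opnorm (a b : nat) (A : 'M[R]_(a, b)) : R :=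
  sup [set enorm (A *m u) | u in [set u : 'cV[R]_b | enorm u <= 1]].

Definition has_grad (m : nat) (F : 'cV[R]_m -> R) (G : 'cV[R]_m -> 'cV[R]_m) :=
  forall z e, 0 < e -> exists2 d, 0 < d & forall h : 'cV[R]_m,
    enorm h < d -> `|F (z + h) - F z - dot (G z) h| <= e * enorm h.

Definition has_jac (m k : nat) (F : 'cV[R]_m -> 'cV[R]_k)
    (J : 'cV[R]_m -> 'M[R]_(k, m)) :=
  forall z e, 0 < e -> exists2 d, 0 < d & forall h : 'cV[R]_m,
    enorm h < d -> enorm (F (z + h) - F z - J z *m h) <= e * enorm h.

Definition convex_vset (m : nat) (S : set 'cV[R]_m) :=
  forall a b t, S a -> S b -> 0 <= t <= 1 -> S (t *: a + (1 - t) *: b).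

Definition abs_cont_curve (m : nat) (gam : R -> 'cV[R]_m) :=
  forall e, 0 < e -> exists2 d, 0 < d & forall (K : nat) (a b : nat -> R),
    (forall i, (i < K)%N -> 0 <= a i /\ a i <= b i /\ b i <= 1) ->
    (forall i j, (i < K)%N -> (j < K)%N -> i <> j -> b i <= a j \/ b j <= a i) ->
    \sum_(i < K) (b i - a i) < d ->
    \sum_(i < K) enorm (gam (b i) - gam (a i)) < e.

Definition field_integrand (m : nat) (D : 'cV[R]_m -> set 'cV[R]_m)
    (gam : R -> 'cV[R]_m) (t : R) : R :=
  sup [set dot (derive1 gam t) v | v in D (gam t)].

Definition field_integral (m : nat) (D : 'cV[R]_m -> set 'cV[R]_m)
    (gam : R -> 'cV[R]_m) : \bar R :=
  (\int[lebesgue_measure]_(t in `[0%R, 1%R]%classic) (field_integrand D gam t)%:E)%E.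

Definition conservative_field (m : nat) (D : 'cV[R]_m -> set 'cV[R]_m) :=
  closed [set zv : 'cV[R]_m * 'cV[R]_m | D zv.1 zv.2]
  /\ (forall z, D z !=set0 /\ compact (D z))
  /\ (forall gam, abs_cont_curve gam -> gam 0 = gam 1 ->
        field_integral D gam = 0%E).

Definition potential_of (m : nat) (F : 'cV[R]_m -> R) (D : 'cV[R]_m -> set 'cV[R]_m) :=
  forall gam, abs_cont_curve gam ->
    field_integral D gam = (F (gam 1) - F (gam 0))%:E.

Definition seq_limit_point (m : nat) (u : nat -> 'cV[R]_m) (l : 'cV[R]_m) :=
  forall e, 0 < e -> forall N, exists2 k, (N <= k)%N & enorm (u k - l) < e.

Definition grady (n p : nat) (G : 'cV[R]_(n + p) -> 'cV[R]_(n + p)) z : 'cV[R]_p :=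
  dsubmx (G z).
Definition hessyy (n p : nat) (H : 'cV[R]_(n + p) -> 'M[R]_(n + p)) z : 'M[R]_p :=
  drsubmx (H z).
(* entries d^2 g / dx_i dy_j *)
Definition hessxy (n p : nat) (H : 'cV[R]_(n + p) -> 'M[R]_(n + p)) z : 'M[R]_(n, p) :=
  (dlsubmx (H z))^T.

Definition stationary (n p : nat) (D : 'cV[R]_(n + p) -> set 'cV[R]_(n + p))
    (G : 'cV[R]_(n + p) -> 'cV[R]_(n + p)) (H : 'cV[R]_(n + p) -> 'M[R]_(n + p))
    (x : 'cV[R]_n) (y : 'cV[R]_p) :=
  (exists dx dy, D (col_mx x y) (col_mx dx dy) /\
     dx - hessxy H (col_mx x y) *m (invmx (hessyy H (col_mx x y)) *m dy) = 0)
  /\ grady G (col_mx x y) = 0.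

Definition Amap (n p : nat) (G : 'cV[R]_(n + p) -> 'cV[R]_(n + p))
    (H : 'cV[R]_(n + p) -> 'M[R]_(n + p)) (x : 'cV[R]_n) (y : 'cV[R]_p) : 'cV[R]_p :=
  y - invmx (hessyy H (col_mx x y)) *m grady G (col_mx x y).

Definition hfun (n p : nat) (f : 'cV[R]_(n + p) -> R) (beta : R)
    (G : 'cV[R]_(n + p) -> 'cV[R]_(n + p)) (H : 'cV[R]_(n + p) -> 'M[R]_(n + p))
    (x : 'cV[R]_n) (y : 'cV[R]_p) : R :=
  f (col_mx x (Amap G H x y)) + beta / 2 * enorm (grady G (col_mx x y)) ^+ 2.

End Defs.

(* Main.v *)
(** A nonsmooth Lyapunov argument for h. The limit of the time-shifted iterates
    along an ultrafilter on the indices is a Lipschitz curve (no extraction of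
    subsequences is needed) whose velocity, wherever it exists, is a limit of weighted
    averages of search directions; by upper semicontinuity and convexity of the
    conservative field it is therefore the exact direction at the current point.
    Lipschitz functions of one variable are differentiable almost everywhere and
    satisfy the fundamental theorem of calculus (the Lebesgue-Stieltjes measure of
    F(t) + K t is absolutely continuous; apply Radon-Nikodym and Lebesgue
    differentiation). Running the curve backwards turns the maximum in the definition of
    a potential into a minimum, so along the curve f(x, A(x, y)) changes at most as
    predicted by any element of the field; with the choice of the parameters h then
    decreases at a positive rate near a nonstationary point. Hence h cannot
    oscillate across a level that is not a stationary value, which by the Sard-type
    hypothesis (c) forces convergence of h along the iterates, and no limit point can be
    nonstationary. *)
Require Import Defs.
From HB Require Import structures.
From mathcomp Require Import all_boot all_order all_algebra.
From mathcomp Require Import all_classical all_reals all_analysis.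
From mathcomp Require Import ring lra.
Set Implicit Arguments. Unset Strict Implicit. Unset Printing Implicit Defensive.
Import Order.TTheory GRing.Theory Num.Theory.
Import numFieldNormedType.Exports.
Local Open Scope classical_set_scope.
Local Open Scope ring_scope.

(** * Euclidean norms *)

Section Euclid.
Variable R : realType.
Implicit Types m n p : nat.

(** Elements of the field say something about f only after integration along a curve, so no one-step
    descent inequality is at hand: the decrease is proved on a continuous limit and carried back to
    the iterates by the local Lipschitz continuity of h. The composite of f with A never receives a
    field of its own: the integral identity is applied to the image curve (x, A(x, y)), and A enters
    through a first-order estimate. There its Newton form pays: the displacement of y cancels, up to
    the variation of the inverse Hessian applied to the y-gradient r of g, which is of size Qg /
    mu^2 times |r| times the displacement. With the factor Mf this coefficient is at most beta mu /
    4, by the bound on beta; the bound on betahat lets the penalty absorb this term and the cross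
    term between r and the x-direction. The two tolerances act differently: the error in w_k
    displaces the point at which the field is evaluated, so upper semicontinuity removes it once it
    tends to 0; the error in v_k perturbs the step itself, so it is summed with the step sizes. *)

Lemma dotC m (u v : 'cV[R]_m) : dot u v = dot v u.
Proof. by apply: eq_bigr => i _; rewrite mulrC. Qed.

Lemma dotDl m (u v w : 'cV[R]_m) : dot (u + v) w = dot u w + dot v w.
Proof. by rewrite -big_split; apply: eq_bigr => i _; rewrite mxE mulrDl. Qed.

Lemma dotZl m a (u v : 'cV[R]_m) : dot (a *: u) v = a * dot u v.
Proof. by rewrite /dot mulr_sumr; apply: eq_bigr => i _; rewrite mxE mulrA. Qed.

Lemma dotNl m (u v : 'cV[R]_m) : dot (- u) v = - dot u v.
Proof. by rewrite -scaleN1r dotZl mulN1r. Qed.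

Lemma dotDr m (u v w : 'cV[R]_m) : dot w (u + v) = dot w u + dot w v.
Proof. by rewrite !(dotC w) dotDl. Qed.

Lemma dotZr m a (u v : 'cV[R]_m) : dot u (a *: v) = a * dot u v.
Proof. by rewrite !(dotC u) dotZl. Qed.

Lemma dotNr m (u v : 'cV[R]_m) : dot u (- v) = - dot u v.
Proof. by rewrite !(dotC u) dotNl. Qed.

Lemma dot0r m (u : 'cV[R]_m) : dot u 0 = 0.
Proof. by rewrite -(scale0r 0) dotZr mul0r. Qed.

Definition dotE := (dotDl, dotDr, dotZl, dotZr, dotNl, dotNr).

Lemma dot_ge0 m (u : 'cV[R]_m) : 0 <= dot u u.
Proof. by apply: sumr_ge0 => i _; rewrite -expr2 sqr_ge0. Qed.

Lemma dot_eq0 m (u : 'cV[R]_m) : dot u u = 0 -> u = 0.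
Proof.
move=> /eqP; rewrite /dot psumr_eq0; last by move=> i _; rewrite -expr2 sqr_ge0.
move=> /allP h; apply/matrixP => i j; rewrite ord1 mxE.
have /implyP/(_ isT) := h i (mem_index_enum _).
by rewrite mulf_eq0 orbb => /eqP.
Qed.

Lemma enorm_ge0 m (u : 'cV[R]_m) : 0 <= enorm u.
Proof. exact: sqrtr_ge0. Qed.

Lemma enorm_sqr m (u : 'cV[R]_m) : enorm u ^+ 2 = dot u u.
Proof. by rewrite sqr_sqrtr// dot_ge0. Qed.

Lemma enorm_eq0 m (u : 'cV[R]_m) : enorm u = 0 -> u = 0.
Proof. by move=> u0; apply: dot_eq0; rewrite -enorm_sqr u0 expr0n. Qed.

Lemma enorm0 m : enorm (0 : 'cV[R]_m) = 0.
Proof. by rewrite /enorm dot0r sqrtr0. Qed.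

Lemma enormZ m a (u : 'cV[R]_m) : enorm (a *: u) = `|a| * enorm u.
Proof.
rewrite /enorm !dotE mulrA -expr2 sqrtrM ?sqr_ge0//.
by rewrite sqrtr_sqr.
Qed.

Lemma enormN m (u : 'cV[R]_m) : enorm (- u) = enorm u.
Proof. by rewrite -scaleN1r enormZ normrN1 mul1r. Qed.

Lemma enormBC m (u v : 'cV[R]_m) : enorm (u - v) = enorm (v - u).
Proof. by rewrite -enormN opprB. Qed.

Lemma cauchy_schwarz m (u v : 'cV[R]_m) : `|dot u v| <= enorm u * enorm v.
Proof.
rewrite -ler_sqr ?nnegrE ?mulr_ge0 ?enorm_ge0// exprMn !enorm_sqr real_normK ?num_real//.
have [v0|v0] := eqVneq (dot v v) 0.
  by rewrite (dot_eq0 v0) !dot0r mulr0 expr0n.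
have vpos : 0 < dot v v by rewrite lt_neqAle eq_sym v0 dot_ge0.
have := dot_ge0 (dot v v *: u - dot u v *: v).
rewrite !dotE (dotC v u).
set a := dot u u; set b := dot v v in vpos *; set c := dot u v.
move=> h; rewrite -subr_ge0 -(pmulr_rge0 _ vpos).
by apply: (le_trans h); rewrite le_eqVlt; apply/orP; left; apply/eqP; ring.
Qed.

Lemma dot_le m (u v : 'cV[R]_m) : dot u v <= enorm u * enorm v.
Proof. exact: le_trans (ler_norm _) (cauchy_schwarz _ _). Qed.

Lemma enormD m (u v : 'cV[R]_m) : enorm (u + v) <= enorm u + enorm v.
Proof.
rewrite -ler_sqr ?nnegrE ?addr_ge0 ?enorm_ge0// enorm_sqr !dotE (dotC v u) sqrrD !enorm_sqr.
by have := dot_le u v; lra.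
Qed.

Lemma enormB m (u v : 'cV[R]_m) : enorm (u - v) <= enorm u + enorm v.
Proof. by rewrite -(enormN v) enormD. Qed.

Lemma enorm_trans m (w u v : 'cV[R]_m) : enorm (u - v) <= enorm (u - w) + enorm (w - v).
Proof. by rewrite -[u - v](subrKA w) enormD. Qed.

Lemma enorm_subl m (u v : 'cV[R]_m) : enorm u <= enorm v + enorm (u - v).
Proof. by rewrite -{1}(subrKC v u) enormD. Qed.

Lemma enorm_lip m (u v : 'cV[R]_m) : `|enorm u - enorm v| <= enorm (u - v).
Proof.
rewrite ler_norml; have := enorm_subl u v; have := enorm_subl v u.
by rewrite enormBC; lra.
Qed.

Lemma enorm_sum m (I : Type) (s : seq I) (P : pred I) (F : I -> 'cV[R]_m) :
  enorm (\sum_(i <- s | P i) F i) <= \sum_(i <- s | P i) enorm (F i).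
Proof.
elim/big_ind2: _ => [|u a v b ua vb|//]; first by rewrite enorm0.
exact: le_trans (enormD _ _) (lerD ua vb).
Qed.

Lemma coord_le_enorm m (u : 'cV[R]_m) i : `|u i 0| <= enorm u.
Proof.
rewrite -ler_sqr ?nnegrE ?enorm_ge0// enorm_sqr real_normK ?num_real// /dot (bigD1 i)//=.
by rewrite -expr2 lerDl; apply: sumr_ge0 => j _; rewrite -expr2 sqr_ge0.
Qed.

Lemma enorm_delta m (i : 'I_m) : enorm (delta_mx i 0 : 'cV[R]_m) = 1.
Proof.
rewrite /enorm /dot (bigD1 i)//= big1 ?addr0 => [|j /negbTE ji].
  by rewrite !mxE !eqxx mulr1 sqrtr1.
by rewrite !mxE ji mul0r.
Qed.

Lemma enorm_le_sum m (u : 'cV[R]_m) : enorm u <= \sum_i `|u i 0|.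
Proof.
rewrite {1}[u]matrix_sum_delta; apply: (le_trans (enorm_sum _ _ _)).
by apply: ler_sum => i _; rewrite big_ord1 enormZ enorm_delta mulr1.
Qed.

Lemma dot_col_mx n p (a c : 'cV[R]_n) (b d : 'cV[R]_p) :
  dot (col_mx a b) (col_mx c d) = dot a c + dot b d.
Proof.
rewrite /dot big_split_ord/=; congr (_ + _); apply: eq_bigr => i _.
- by rewrite !col_mxEu.
- by rewrite !col_mxEd.
Qed.

Lemma enorm_usubmx n p (z : 'cV[R]_(n + p)) : enorm (usubmx z) <= enorm z.
Proof.
rewrite -{2}(vsubmxK z) -ler_sqr ?nnegrE ?enorm_ge0// !enorm_sqr dot_col_mx.
by rewrite lerDl dot_ge0.
Qed.

Lemma enorm_dsubmx n p (z : 'cV[R]_(n + p)) : enorm (dsubmx z) <= enorm z.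
Proof.
rewrite -{2}(vsubmxK z) -ler_sqr ?nnegrE ?enorm_ge0// !enorm_sqr dot_col_mx.
by rewrite lerDr dot_ge0.
Qed.

Lemma enorm_col_mx n p (a : 'cV[R]_n) (b : 'cV[R]_p) :
  enorm (col_mx a b) <= enorm a + enorm b.
Proof.
rewrite -ler_sqr ?nnegrE ?addr_ge0 ?enorm_ge0// enorm_sqr dot_col_mx sqrrD !enorm_sqr.
have := mulr_ge0 (enorm_ge0 a) (enorm_ge0 b); lra.
Qed.

Lemma enorm_col_mx0 n p (a : 'cV[R]_n) : enorm (col_mx a (0 : 'cV[R]_p)) = enorm a.
Proof. by rewrite /enorm dot_col_mx dot0r addr0. Qed.

Lemma enorm_col_0mx n p (b : 'cV[R]_p) : enorm (col_mx (0 : 'cV[R]_n) b) = enorm b.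
Proof. by rewrite /enorm dot_col_mx dot0r add0r. Qed.

Lemma dot_mulmx m n (A : 'M[R]_(m, n)) u v : dot u (A *m v) = dot (A^T *m u) v.
Proof.
have dotmx k (a b : 'cV[R]_k) : dot a b = (a^T *m b) 0 0.
  by rewrite mxE; apply: eq_bigr => i _; rewrite mxE.
by rewrite !dotmx trmx_mul trmxK mulmxA.
Qed.

(** The entrywise bound is crude, but it makes the set in [opnorm] bounded above; without that its
    [sup] would carry no information. *)
Lemma mulmx_bounded m n (A : 'M[R]_(m, n)) :
  exists C, forall u, enorm (A *m u) <= C * enorm u.
Proof.
exists (\sum_i \sum_j `|A i j|) => u.
apply: (le_trans (enorm_le_sum _)); rewrite mulr_suml; apply: ler_sum => i _.
rewrite mxE mulr_suml; apply: (le_trans (ler_norm_sum _ _ _)); apply: ler_sum => j _.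
by rewrite normrM ler_wpM2l// coord_le_enorm.
Qed.

Lemma opnormP m n (A : 'M[R]_(m, n)) (u : 'cV[R]_n) :
  enorm (A *m u) <= opnorm A * enorm u.
Proof.
have [C CA] := mulmx_bounded A.
have [u0|u0] := eqVneq (enorm u) 0.
  by rewrite (enorm_eq0 u0) mulmx0 !enorm0 mulr0.
have upos : 0 < enorm u by rewrite lt_neqAle eq_sym u0 enorm_ge0.
rewrite -ler_pdivrMr// mulrC -[X in X * _]ger0_norm ?invr_ge0 ?enorm_ge0//.
rewrite -enormZ scalemxAr; apply: sup_ubound; last first.
  exists ((enorm u)^-1 *: u) => //=.
  by rewrite enormZ ger0_norm ?invr_ge0 ?enorm_ge0// mulVf.
exists `|C| => _ [v /= v1 <-]; apply: (le_trans (CA v)).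
apply: (@le_trans _ _ (`|C| * enorm v)).
  by apply: ler_wpM2r; [exact: enorm_ge0|exact: ler_norm].
by rewrite -[leRHS]mulr1 ler_wpM2l.
Qed.

Lemma opnorm_le m n (A : 'M[R]_(m, n)) C u :
  opnorm A <= C -> enorm (A *m u) <= C * enorm u.
Proof. by move=> AC; apply: (le_trans (opnormP _ _)); rewrite ler_wpM2r// enorm_ge0. Qed.

(** The row kernel of the transpose is the column kernel of A. *)
Lemma unitmx_inj n (A : 'M[R]_n) :
  (forall u : 'cV[R]_n, A *m u = 0 -> u = 0) -> A \in unitmx.
Proof.
move=> Ainj; rewrite -unitmx_tr -row_free_unit -kermx_eq0.
apply/eqP/row_matrixP => i; rewrite row0.
apply: trmx_inj; rewrite trmx0; apply: Ainj; apply: trmx_inj.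
by rewrite trmx_mul trmxK -row_mul mulmx_ker row0 trmx0.
Qed.

End Euclid.

(** * Lipschitz functions and integrals *)

Section LipschitzFTC.
Variable R : realType.
Notation mu := (@lebesgue_measure R).

Lemma lipschitz_real_continuous (F : R -> R) (L : R) :
  (forall a b, `|F a - F b| <= L * `|a - b|) -> continuous F.
Proof.
move=> Flip t; apply/cvgrPdist_le => e e0.
have L0 : 0 < Num.max L 0 + 1 by rewrite ltr_pwDr// le_max lexx orbT.
near=> s.
apply: (le_trans (Flip _ _)).
apply: (@le_trans _ _ ((Num.max L 0 + 1) * `|t - s|)).
  by apply: ler_wpM2r => //; rewrite ler_wpDr// le_max lexx.
rewrite -ler_pdivlMl//.
near: s; apply: cvgr_dist_le; first exact: cvg_id.
by rewrite mulr_gt0 ?invr_gt0.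
Unshelve. all: by end_near. Qed.

(** The increments of the two functions over an interval add up to K times its length, so by
    uniqueness of Lebesgue measure the two Stieltjes measures add up to K times it. Both are
    nonnegative, so a Lebesgue null set is null for each. *)
Lemma stieltjes_dominated (G1 G2 : cumulative R R) (K : R) : 0 < K ->
  (forall t, G1 t + G2 t = K * t) ->
  lebesgue_stieltjes_measure G1 `<< (mu : set (measurableTypeR R) -> \bar R).
Proof.
move=> K0 GK.
have lsE (G : cumulative R R) a b : a <= b ->
    lebesgue_stieltjes_measure G `]a, b]%classic = (G b - G a)%:E.
  move=> ab; rewrite /lebesgue_stieltjes_measure /measure_extension.
  rewrite measurable_mu_extE/=; last exact: is_ocitv.
  by rewrite wlength_itv_bnd.
have Ki0 : 0 <= K^-1 by rewrite invr_ge0 ltW.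
pose m := mscale (NngNum Ki0)
  (measure_add (lebesgue_stieltjes_measure G1) (lebesgue_stieltjes_measure G2)).
have mAE A : m A = ((K^-1)%:E * (lebesgue_stieltjes_measure G1 A +
    lebesgue_stieltjes_measure G2 A))%E by rewrite -measure_addE.
have mE : forall A, measurable A -> mu A = m A.
  apply: lebesgue_measure_unique => _ /ocitvP[->|[[a b]/= ab ->]].
    by rewrite !measure0.
  apply: etrans (esym (mAE _)).
  rewrite !lsE ?ltW//= lebesgue_measure_itv/= lte_fin ab.
  rewrite -?EFinB -?EFinD -?EFinM; congr EFin.
  have -> : G1 b - G1 a + (G2 b - G2 a) = (G1 b + G2 b) - (G1 a + G2 a) by ring.
  by rewrite !GK; field; rewrite gt_eqF.
apply/null_content_dominatesP => A mA muA0.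
have := etrans (esym (mAE A)) (esym (mE _ mA)); rewrite muA0 => /eqP.
rewrite mule_eq0 => /orP[|].
  by rewrite eqe invr_eq0 gt_eqF.
rewrite padde_eq0 ?measure_ge0//.
by move=> /andP[/eqP].
Qed.

Lemma lipschitz_FTC (F : R -> R) (L : R) :
  (forall a b, `|F a - F b| <= L * `|a - b|) ->
  exists phi : R -> R, [/\ mu.-integrable `[0, 1]%classic (EFin \o phi),
    {ae mu, forall t : R, t \in `]0, 1[ -> is_derive t 1 F (phi t)} &
    (\int[mu]_(t in `[0%R, 1%R]%classic) (phi t)%:E = (F 1 - F 0)%:E)%E].
Proof.
move=> Flip0.
(* Positive whatever the sign of L, and large enough for both K t + F and K t - F to be
   nondecreasing. *)
pose K := `|L| + 1.
have K0 : 0 < K by rewrite ltr_pwDr.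
have Flip a b : a <= b -> `|F b - F a| <= K * (b - a).
  move=> ab; apply: (le_trans (Flip0 _ _)).
  rewrite ger0_norm ?subr_ge0//; apply: ler_wpM2r; first by rewrite subr_ge0.
  by rewrite (le_trans (ler_norm _))// lerDl.
have cF := lipschitz_real_continuous Flip0.
have nd1 : nondecreasing (fun t => K * t + F t).
  move=> a b ab /=; have := Flip _ _ ab; rewrite ler_norml => /andP[h1 h2].
  by rewrite mulrBr in h1; lra.
have nd2 : nondecreasing (fun t => K * t - F t).
  move=> a b ab /=; have := Flip _ _ ab; rewrite ler_norml => /andP[h1 h2].
  by rewrite mulrBr in h2; lra.
have rc1 : right_continuous (fun t => K * t + F t).
  apply/right_continuousW => t; apply: cvgD; last exact: cF.
  by apply: cvgM; [exact: cvg_cst|exact: cvg_id].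
have rc2 : right_continuous (fun t => K * t - F t).
  apply/right_continuousW => t; apply: cvgB; last exact: cF.
  by apply: cvgM; [exact: cvg_cst|exact: cvg_id].
pose G1 : cumulative R R := HB.pack (fun t => K * t + F t)
  (isCumulative.Build R _ R _ nd1 rc1).
pose G2 : cumulative R R := HB.pack (fun t => K * t - F t)
  (isCumulative.Build R _ R _ nd2 rc2).
have dom := @stieltjes_dominated G1 G2 (2 * K) ltac:(lra)
  ltac:(by move=> t /=; ring).
have lsE a b : a <= b ->
    lebesgue_stieltjes_measure G1 `]a, b]%classic = (G1 b - G1 a)%:E.
  move=> ab; rewrite /lebesgue_stieltjes_measure /measure_extension.
  rewrite measurable_mu_extE/=; last exact: is_ocitv.
  by rewrite wlength_itv_bnd.
have mD : measurable (`]0, 1]%classic : set (measurableTypeR R)).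
  exact: measurable_itv.
have fD : (lebesgue_stieltjes_measure G1 `]0%R, 1%R]%classic < +oo)%E.
  by rewrite lsE ?ltry.
(* The restriction to ]0, 1] is finite, so its density is integrable on the whole line and the
   primitive from -oo can be differentiated. *)
pose nu := mfrestr mD fD.
have nuE A : nu A = lebesgue_stieltjes_measure G1 (A `&` `]0, 1]%classic).
  by [].
have numu : nu `<< (mu : set (measurableTypeR R) -> \bar R).
  apply/null_content_dominatesP => A mA muA0; rewrite nuE.
  apply: (null_content_dominatesP _ _).1 dom _ _ _; first exact: measurableI.
  apply/eqP; rewrite eq_le measure_ge0 andbT -muA0 le_measure ?inE//.
  exact: measurableI.
have [phi [phi0 phifin phiint phiE]] := radon_nikodym_sigma_finite numu.
have ephi : EFin \o (fine \o phi) = phi.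
  by apply/funext => t /=; rewrite fineK.
have iphi : mu.-integrable setT (EFin \o (fine \o phi)) by rewrite ephi.
have PhiE x : x \in `]0, 1[ ->
    (\int[mu]_(t in [set` `]-oo, x]]) (fine \o phi) t)%R = G1 x - G1 0.
  move=> /itvP xI; rewrite /Rintegral.
  under eq_integral do rewrite /= fineK//.
  transitivity (fine (nu `]-oo, x]%classic)).
    by congr fine; apply/esym; apply: phiE; exact: measurable_itv.
  rewrite nuE.
  have -> : `]-oo, x]%classic `&` `]0, 1]%classic = `]0, x]%classic :> set R.
    apply/seteqP; split => y /=; rewrite !in_itv/=.
      by move=> [-> /andP[->]].
    by move=> /andP[-> yx]; split=> //; rewrite (le_trans yx)// xI.
  by rewrite lsE//= xI.
have icst : mu.-integrable `[0, 1]%classic (EFin \o cst K).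
  apply: continuous_compact_integrable; first exact: segment_compact.
  by apply: continuous_subspaceT => t; exact: cvg_cst.
have iphi01 : mu.-integrable `[0, 1]%classic phi.
  by apply: integrableS phiint.
exists (fun t => fine (phi t) - K); split.
- apply: (eq_integrable _ (phi \- (EFin \o cst K))%E) => //.
    by move=> t _ /=; rewrite EFinB fineK.
  exact: integrableB.
- have /(_ _)/= := @FTC1Ny R (fine \o phi).
  case=> [y| |].
  + by apply: integrableS iphi.
  + by apply: open_integrable_locally => //; exact: openT.
  move=> N [mN N0 subN]; exists N; split => // t tN; apply: subN => /= -[dPhi PhiE'].
  apply: tN => tI /=.
  pose Phi := fun x : R => (\int[mu]_(t in [set` `]-oo, x]]) (fine \o phi) t)%R.
  have dP : is_derive t 1 Phi (fine (phi t)).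
    by apply: DeriveDef dPhi _; rewrite -derive1E.
  have dH : is_derive t 1 (fun x => Phi x - K * x + F 0) (fine (phi t) - K).
    apply: is_derive_eq; rewrite ?scaler0 ?addr0 ?scaler1.
    ring.
  (* F agrees with the primitive, up to an affine term, on ]0, 1[ only; this suffices for the
     derivative at an interior point. *)
  apply: near_eq_is_derive dH.
  near=> x; rewrite /Phi PhiE /=; last first.
    by near: x; exact: near_in_itvoo.
  by ring.
- under eq_integral do rewrite EFinB fineK//.
  rewrite integralB//.
  have -> : (\int[mu]_(x in `[0%R, 1%R]%classic) phi x)%E = nu `[0%R, 1%R]%classic.
    by apply/esym; apply: phiE; exact: measurable_itv.
  rewrite nuE.
  have -> : `[0%R, 1%R]%classic `&` `]0%R, 1%R]%classic = `]0%R, 1%R]%classic :> set R.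
    by apply/setIidPr; apply: subset_itvr; rewrite bnd_simp.
  rewrite lsE//= integral_cst//= lebesgue_measure_itv/= lte_fin ltr01.
  by rewrite -?EFinB -?EFinM -?EFinB; congr EFin; ring.
Unshelve. all: by end_near. Qed.
End LipschitzFTC.

(* No measurability is assumed, so that the lemma applies to the supremum over a set-valued field. *)
Lemma integral_monotone (d : measure_display) (T : measurableType d) (R : realType)
    (m : {measure set T -> \bar R}) (A : set T) (g1 g2 : T -> \bar R) :
  (forall t, A t -> (g1 t <= g2 t)%E) ->
  (\int[m]_(t in A) g1 t <= \int[m]_(t in A) g2 t)%E.
Proof.
move=> g12; have g12A t : ((g1 \_ A) t <= (g2 \_ A) t)%E by exact: lee_restrict.
rewrite /integral; apply: leeB; apply: ereal_sup_le => _ [h /= hg <-]; exists h => //= t.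
- by rewrite (le_trans (hg t))// funeposE funeposE ge_max !le_max lexx orbT g12A.
- by rewrite (le_trans (hg t))// funenegE funenegE ge_max !le_max lexx orbT leeN2 g12A.
Qed.

(** The larger function may fail to be measurable, so only [psi] may be altered on a null set.
    Setting it to -oo there, endpoints included, keeps its integral and makes the inequality hold
    everywhere. *)
Lemma integral_ae_ge (R : realType) (f psi : R -> R) :
  (@lebesgue_measure R).-integrable `[0, 1]%classic (EFin \o psi) ->
  {ae (@lebesgue_measure R), forall t : R, t \in `]0, 1[ -> psi t <= f t} ->
  (\int[@lebesgue_measure R]_(t in `[0%R, 1%R]%classic) (psi t)%:E <=
   \int[@lebesgue_measure R]_(t in `[0%R, 1%R]%classic) (f t)%:E)%E.
Proof.
move=> ipsi [N [mN N0 subN]].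
pose N' : set R := N `|` ([set 0] `|` [set 1]).
have mN' : measurable N' by apply: measurableU => //; apply: measurableU.
have null1 (r : R) : lebesgue_measure [set r] = 0%E by exact: lebesgue_measure_set1.
have N'0 : lebesgue_measure N' = 0%E.
  apply/eqP; rewrite eq_le measure_ge0 andbT.
  apply: (le_trans (measureU2 _ _ _)) => //; first exact: measurableU.
  rewrite -[leRHS]adde0; apply: leeD; first exact: (eq_ind_r (fun a => (a <= 0)%E) (lexx _) N0).
  apply: (le_trans (measureU2 _ _ _)) => //.
  rewrite -[leRHS]adde0; apply: leeD;
    exact: (eq_ind_r (fun a => (a <= 0)%E) (lexx _) (null1 _)).
pose psi' (t : R) : \bar R := if t \in N' then -oo%E else (psi t)%:E.
have -> : (\int[@lebesgue_measure R]_(t in `[0%R, 1%R]%classic) (psi t)%:E =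
    \int[@lebesgue_measure R]_(t in `[0%R, 1%R]%classic) psi' t)%E.
  apply: ae_eq_integral => //.
  - exact: measurable_int ipsi.
  - rewrite /psi'; apply: measurable_fun_if => //.
    + apply: (measurable_fun_bool true); rewrite preimage_mem_true.
      exact: measurableI.
    + apply: measurable_funS (measurable_int _ ipsi) => //.
  - exists N'; split => // t /= h; apply: contrapT => tN'; apply: h => _.
    by rewrite /psi' memNset.
apply: integral_monotone => t /= tI; rewrite /psi'; case: ifPn; first by rewrite leNye.
move=> /negP tN'; rewrite lee_fin.
have [tN|tN] := pselect (N t).
  by exfalso; apply: tN'; rewrite inE; left.
have : t \in `]0, 1[ -> psi t <= f t by apply: contrapT => h; apply: tN; exact: subN.
apply; move: tI; rewrite !in_itv/= => /andP[t0 t1].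
rewrite !lt_neqAle t0 t1 !andbT; apply/andP; split; apply/eqP => te; apply: tN'; rewrite inE.
- by right; left.
- by right; right.
Qed.

(** * Limit curves of discrete dynamics *)

Section UltraLimit.
Variables (R : realType) (U : set_system nat).
Hypothesis UU : UltraFilter U.

(** Along an ultrafilter every bounded sequence converges, so one ultrafilter serves the uncountably
    many times of a limit curve at once. *)
Definition ulim m (u : nat -> 'cV[R]_m) l :=
  forall e, 0 < e -> U [set k | enorm (u k - l) < e].

Lemma ulim_real_exists (u : nat -> R) B : (forall k, `|u k| <= B) ->
  exists l, forall e, 0 < e -> U [set k | `|u k - l| < e].
Proof.
move=> uB.
have cs : compact (`[- B, B]%classic : set R) by exact: segment_compact.
have PF : ProperFilter (u @ U) by apply: fmap_proper_filter.
have [|l [_ cl]] := cs _ PF.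
  by apply: (@filterE _ U _) => k /=; rewrite in_itv/= -ler_norml.
exists l => e e0.
(* An ultrafilter contains this set or its complement; the complement would keep the sequence away
   from its cluster point [l]. *)
have [//|h] := in_ultra_setVsetC [set k | `|u k - l| < e] UU.
have [y [/= [k /= kl <-]]] := cl _ (ball l e)
  (filterS (fun k (hk : (~` [set k | `|u k - l| < e]) k) =>
     (ex_intro2 _ _ k hk erefl : [set u k | k in ~` [set k | `|u k - l| < e]] (u k))) h)
  (nbhsx_ballx l e e0).
by rewrite /ball/= distrC.
Qed.

Lemma ulim_exists m (u : nat -> 'cV[R]_m) B : (forall k, enorm (u k) <= B) ->
  exists l, ulim u l.
Proof.
move=> uB.
have h i : exists l, forall e, 0 < e -> U [set k | `|u k i 0 - l| < e].
  by apply: (@ulim_real_exists _ B) => k; exact: le_trans (coord_le_enorm _ _) (uB k).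
have [l lP] := choice h.
exists (\col_i l i) => e e0.
(* [m.+1] allows dimension 0 and makes the final inequality strict. *)
have d0 : 0 < e / (m.+1)%:R by rewrite divr_gt0.
have : U [set k | forall i, `|u k i 0 - l i| < e / (m.+1)%:R].
  by apply: filter_forall => i; exact: lP.
apply: filterS => k /= hk; apply: (le_lt_trans (enorm_le_sum _)).
apply: (@le_lt_trans _ _ (\sum_(i < m) e / (m.+1)%:R)).
  by apply: ler_sum => i _; rewrite !mxE ltW.
rewrite sumr_const card_ord -[_ *+ m]mulr_natr -mulrA -[ltRHS]mulr1 ltr_pM2l//.
by rewrite mulrC ltr_pdivrMr// mul1r ltr_nat.
Qed.

Lemma ulim_le m (u v : nat -> 'cV[R]_m) a b C : ulim u a -> ulim v b ->
  (forall e, 0 < e -> U [set k | enorm (u k - v k) <= C + e]) -> enorm (a - b) <= C.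
Proof.
move=> ua vb uv; apply/ler_addgt0Pr => e e0.
have e3 : 0 < e / 3 by rewrite divr_gt0.
have [k /= [[h1 h2] h3]] := filter_ex (filterI (filterI (ua _ e3) (vb _ e3)) (uv _ e3)).
have := enorm_trans (u k) a b; have := enorm_trans (v k) (u k) b.
by rewrite (enormBC a (u k)); lra.
Qed.

End UltraLimit.

(** * Perturbed descent recursions observed in elapsed time *)

Section Discrete.
Variables (R : realType) (m : nat) (z P xi : nat -> 'cV[R]_m) (eta th : nat -> R).
Variables (M B : R).
Hypothesis hz : forall i, z i.+1 = z i - eta i *: P i + xi i.
Hypothesis hP : forall i, enorm (P i) <= M.
Hypothesis hB : forall i, enorm (z i) <= B.
Hypothesis eta0 : forall i, 0 <= eta i.
Hypothesis eta_cvg0 : forall e, 0 < e -> exists N, forall k, (N <= k)%N -> eta k < e.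
Hypothesis hxi : forall i, enorm (xi i) <= th i.
Hypothesis th_cauchy : forall e, 0 < e -> exists N, forall k l, (N <= k)%N -> (k <= l)%N ->
  series th l - series th k < e.

Notation S := (series eta).

(** [idx T] is the step in progress at elapsed time T, so [z] after [idx] is the piecewise constant
    interpolation of the iterates. The strict upper bound skips steps of length zero. *)
Variable idx : R -> nat.
Hypothesis idxP : forall T, 0 <= T -> S (idx T) <= T < S (idx T).+1.

Lemma speed_bound_ge0 : 0 <= M. Proof. exact: le_trans (enorm_ge0 _) (hP 0%N). Qed.

Lemma elapsed_nd k l : (k <= l)%N -> S k <= S l.
Proof.
move=> kl; rewrite -subr_ge0 sub_series_geq//.
by apply: sumr_ge0 => i _; exact: eta0.
Qed.

Lemma elapsed_ge0 k : 0 <= S k.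
Proof. by apply: sumr_ge0 => i _; exact: eta0. Qed.

Lemma idx_nd T T' : 0 <= T -> T <= T' -> (idx T <= idx T')%N.
Proof.
move=> T0 TT'; rewrite leqNgt; apply/negP => h.
have /andP[h1 _] := idxP T0; have /andP[_ h2] := idxP (le_trans T0 TT').
have := elapsed_nd h; lra.
Qed.

Lemma idx_ge k s : 0 <= s -> (k <= idx (S k + s))%N.
Proof.
move=> s0; rewrite leqNgt; apply/negP => h.
have /andP[_ h2] := idxP (addr_ge0 (elapsed_ge0 k) s0).
have := elapsed_nd h; lra.
Qed.

Lemma iterate_sum k l : (k <= l)%N ->
  z l - z k = - (\sum_(k <= i < l) eta i *: P i) + \sum_(k <= i < l) xi i.
Proof.
move=> kl; rewrite -(telescope_sumr z kl) -sumrN -big_split/=.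
by apply: eq_bigr => i _; rewrite hz [_ - z i]addrC !addrA addNr add0r.
Qed.

Lemma iterate_incr k l : (k <= l)%N ->
  enorm (z l - z k) <= M * (S l - S k) + (series th l - series th k).
Proof.
move=> kl; rewrite iterate_sum//; apply: (le_trans (enormD _ _)); rewrite enormN; apply: lerD.
  apply: (le_trans (enorm_sum _ _ _)); rewrite sub_series_geq// mulr_sumr.
  apply: ler_sum => i _; rewrite enormZ ger0_norm// mulrC ler_wpM2r//.
apply: (le_trans (enorm_sum _ _ _)); rewrite sub_series_geq//.
by apply: ler_sum => i _.
Qed.

Lemma iterate_window e : 0 < e -> exists N, forall k s s', (N <= k)%N -> 0 <= s -> s <= s' ->
  [/\ (N <= idx (S k + s))%N, (idx (S k + s) <= idx (S k + s'))%N,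
   `|S (idx (S k + s')) - S (idx (S k + s)) - (s' - s)| <= e &
   forall i, (idx (S k + s) <= i <= idx (S k + s'))%N ->
     enorm (z i - z (idx (S k + s))) <= M * (s' - s) + e].
Proof.
move=> e0.
have M0 := speed_bound_ge0.
(* Each end of the window misses its time by less than one step. A step below this size costs at
   most e / 2 in distance at speed M; the other half is the tail of the perturbations. *)
have d0 : 0 < e / (2 * (M + 1)) by rewrite divr_gt0// mulr_gt0//; lra.
have [N1 N1P] := eta_cvg0 d0.
have [N2 N2P] := th_cauchy (divr_gt0 e0 (ltr0Sn _ 1) : 0 < e / 2).
exists (maxn N1 N2) => k s s' Nk s0 ss'.
have Na : (maxn N1 N2 <= idx (S k + s))%N by exact: leq_trans Nk (idx_ge _ s0).
have ab : (idx (S k + s) <= idx (S k + s'))%N.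
  by apply: idx_nd; rewrite ?addr_ge0 ?elapsed_ge0// lerD2l.
set a := idx (S k + s) in Na ab *; set b := idx (S k + s') in ab *.
have s'0 := le_trans s0 ss'.
have /andP[a1 a2] := idxP (addr_ge0 (elapsed_ge0 k) s0).
have /andP[b1 b2] := idxP (addr_ge0 (elapsed_ge0 k) s'0).
rewrite -/a -/b in a1 a2 b1 b2.
rewrite seriesSr in a2; rewrite seriesSr in b2.
have /andP[Na1 Na2] : (N1 <= a)%N && (N2 <= a)%N by rewrite -geq_max.
have ea := N1P _ Na1; have eb := N1P _ (leq_trans Na1 ab).
set d := e / (2 * (M + 1)) in d0 ea eb *.
have de : d * (M + 1) = e / 2 by rewrite /d; field; rewrite gt_eqF//; lra.
have dle : d <= e by nra.
split => //.
  by rewrite ler_norml; apply/andP; split; lra.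
move=> i /andP[ai ib]; apply: (le_trans (iterate_incr ai)).
have := elapsed_nd ib; have := N2P _ _ Na2 ai => h1 h2.
have : S i - S a <= s' - s + d by lra.
move=> /(ler_wpM2l M0); rewrite mulrDr; nra.
Qed.

Variables (U : set_system nat).
Hypothesis UU : UltraFilter U.
Hypothesis Uoo : forall N, U [set k | (N <= k)%N].

(** Reflecting time at 0 defines the curve on the whole line with the same Lipschitz constant, as
    the calculus for Lipschitz functions requires. *)
Lemma limit_curve_exists :
  exists zeta : R -> 'cV[R]_m, forall s : R, ulim U (fun k => z (idx (S k + `|s|))) (zeta s).
Proof.
have h (s : R) : exists l : 'cV[R]_m, ulim U (fun k => z (idx (S k + `|s|))) l; last first.
  by have [zt ztP] := choice h; exists zt.
by apply: ulim_exists => k; exact: hB.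
Qed.

Variable zeta : R -> 'cV[R]_m.
Hypothesis zetaP : forall s : R, ulim U (fun k => z (idx (S k + `|s|))) (zeta s).

Lemma limit_curve_lip (s s' : R) : enorm (zeta s - zeta s') <= M * `|s - s'|.
Proof.
have M0 := speed_bound_ge0.
wlog ss' : s s' / `|s| <= `|s'|.
  move=> h; have [|/ltW] := leP `|s| `|s'|; first exact: h.
  by rewrite enormBC distrC; exact: h.
apply: (@le_trans _ _ (M * (`|s'| - `|s|))); last first.
  by rewrite ler_wpM2l// distrC lerB_dist.
rewrite enormBC; apply: (ulim_le UU (zetaP s') (zetaP s)) => e e0.
have [N NP] := iterate_window e0.
apply: filterS (Uoo N) => k /= Nk.
have [_ ab _] := NP _ _ _ Nk (normr_ge0 s) ss'.
by apply; rewrite ab leqnn.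
Qed.

Lemma limit_curve_bound (s : R) : enorm (zeta s) <= B.
Proof.
apply/ler_addgt0Pr => e e0; have [k /= h] := filter_ex (zetaP s e0).
have := enorm_subl (zeta s) (z (idx (S k + `|s|))); rewrite enormBC.
have := hB (idx (S k + `|s|)); lra.
Qed.

Lemma limit_curve_start zs : ulim U z zs -> zeta 0 = zs.
Proof.
move=> zzs; apply/subr0_eq/enorm_eq0/le_anti; rewrite enorm_ge0 andbT.
apply: (ulim_le UU (zetaP 0) zzs) => e e0.
have [N NP] := th_cauchy e0.
apply: filterS (Uoo N) => k /= Nk; rewrite normr0 addr0 add0r.
have ki : (k <= idx (S k))%N by have := idx_ge k (lexx 0); rewrite addr0.
apply: (le_trans (iterate_incr ki)).
have /andP[h _] := idxP (elapsed_ge0 k).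
have /(ler_wpM2l speed_bound_ge0) : S (idx (S k)) - S k <= 0 by rewrite subr_le0.
have := NP _ _ Nk ki; rewrite mulr0; lra.
Qed.

(** A two-sided derivative in the Euclidean norm; [derive1], which uses the norm of matrices, is
    recovered from it in [has_vel_derive1]. *)
Definition has_vel (c : R -> 'cV[R]_m) t p := forall e, 0 < e ->
  exists2 d, 0 < d & forall s, `|s| < d -> enorm (c (t + s) - c t - s *: p) <= e * `|s|.

Lemma convex_avg (C : set 'cV[R]_m) (a : nat -> R) (v : nat -> 'cV[R]_m) k l :
  convex_vset C -> (k <= l)%N ->
  (forall i, (k <= i < l)%N -> 0 <= a i /\ C (v i)) ->
  0 < \sum_(k <= i < l) a i ->
  C ((\sum_(k <= i < l) a i)^-1 *: \sum_(k <= i < l) a i *: v i).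
Proof.
move=> cC; elim: l => [|l IH] kl hC.
  by move: kl; rewrite leqn0 => /eqP->; rewrite big_geq// ltxx.
have [kl'|kl'] := leqP k l; last first.
  by rewrite big_geq ?ltxx//.
rewrite !big_nat_recr//= => sp.
have [al Cl] : 0 <= a l /\ C (v l) by apply: hC; rewrite kl' ltnSn.
have hC' i : (k <= i < l)%N -> 0 <= a i /\ C (v i).
  by move=> /andP[ki il]; apply: hC; rewrite ki ltnS ltnW.
set A := \sum_(k <= i < l) a i in sp *.
have A0 : 0 <= A.
  rewrite /A big_nat_cond; apply: sumr_ge0 => i /andP[/hC'[]]//.
(* If the earlier weights sum to zero they all vanish and the average is the last vector; the
   induction hypothesis could not be normalized. *)
have [A00|A00] := eqVneq A 0.
  have s0 : \sum_(k <= i < l) a i *: v i = 0.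
    rewrite big_nat_cond big1// => i /andP[ki _].
    have /eqP := A00; rewrite /A big_nat_cond psumr_eq0; last by move=> j /andP[/hC'[]].
    move=> /allP/(_ i); rewrite mem_index_iota => /(_ ki); rewrite ki/= => /eqP->.
    by rewrite scale0r.
  rewrite s0 A00 !add0r scalerA mulVf ?scale1r//.
  by rewrite A00 add0r in sp; rewrite gt_eqF.
have Ap : 0 < A by rewrite lt_neqAle eq_sym A00.
have := cC _ _ (A / (A + a l)) (IH kl' hC' Ap) Cl.
rewrite divr_ge0 ?(ltW sp)// ler_pdivrMr// mul1r lerDl al => /(_ isT).
congr (C _); rewrite scalerDr !scalerA; congr (_ *: _ + _ *: _).
  by rewrite -/A; field; rewrite !gt_eqF.
by field; rewrite gt_eqF.
Qed.

(** Over a short window the curve moves by about s p, while the iterates move by minus the window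
    length times a weighted average of directions, which lies in C by convexity. Since C need not be
    closed, -p is only approximated by elements of C. *)
Lemma limit_curve_velocity (C : set 'cV[R]_m) s0 p rho K : convex_vset C -> 0 <= s0 ->
  has_vel zeta s0 p -> 0 < rho ->
  (forall i, (K <= i)%N -> enorm (z i - zeta s0) < rho -> C (P i)) ->
  forall e, 0 < e -> exists2 c, C c & enorm (p + c) <= e.
Proof.
move=> cC s00 vel rho0 hC e e0; have M0 := speed_bound_ge0.
have e40 : 0 < e / 4 by rewrite divr_gt0.
have [d d0 dP] := vel _ e40.
(* Short enough for the chord to be s p up to e s / 4, and for a motion at speed M to stay below rho
   / 4. *)
pose s := Num.min (d / 2) (rho / (4 * (M + 1))).
have s_gt0 : 0 < s by rewrite lt_min !divr_gt0// mulr_gt0//; lra.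
have sd : s < d by rewrite gt_min; apply/orP; left; lra.
have sM : M * s <= rho / 4.
  have /(ler_wpM2l M0) : s <= rho / (4 * (M + 1)) by rewrite ge_min lexx orbT.
  move=> /le_trans; apply; rewrite mulrA ler_pdivrMr ?mulr_gt0//; nra.
(* The three bounds keep the elapsed length L positive, keep the iterates of the window within rho
   of [zeta s0], and pay for replacing L by s. *)
pose e2 := Num.min (Num.min (s / 2) (rho / 4)) (e * s / (8 * (M + 1))).
have es : 0 < e * s by rewrite mulr_gt0.
have e20 : 0 < e2 by rewrite !lt_min !divr_gt0//= mulr_gt0//; lra.
have e2s : e2 <= s / 2 by rewrite !ge_min lexx.
have e2r : e2 <= rho / 4 by rewrite !ge_min lexx orbT.
have e2M : e2 * M <= e * s / 8.
  have /(ler_wpM2r M0) : e2 <= e * s / (8 * (M + 1)) by rewrite ge_min lexx orbT.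
  move=> /le_trans; apply; rewrite mulrAC ler_pdivrMr; last by rewrite mulr_gt0//; lra.
  nra.
have [N NP] := iterate_window e20.
have es8 : 0 < e * s / 8 by rewrite divr_gt0.
have [N3 N3P] := th_cauchy es8.
pose e3 := Num.min (rho / 2) (e * s / 8).
have e30 : 0 < e3 by rewrite lt_min es8 divr_gt0.
have [k /= [[[Nk Kk] N3k] [ha hb]]] := filter_ex (filterI (filterI (filterI (Uoo N) (Uoo K)) (Uoo N3))
  (filterI (zetaP s0 e30) (zetaP (s0 + s) es8))).
have s0s : s0 <= s0 + s by lra.
rewrite !ger0_norm in ha hb; [|lra..].
have [Na ab] := NP _ _ _ Nk s00 s0s.
have ka := idx_ge k s00.
rewrite [s0 + s - s0]addrAC subrr add0r.
set a := idx (S k + s0) in Na ab ka ha *; set b := idx (S k + (s0 + s)) in ab hb *.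
move=> Lam zi.
have [ha1 ha2] : enorm (z a - zeta s0) < rho / 2 /\ enorm (z a - zeta s0) < e * s / 8.
  by split; apply: (lt_le_trans ha); rewrite ge_min lexx ?orbT.
set L := S b - S a in Lam *.
have LE : L = \sum_(a <= i < b) eta i by rewrite /L sub_series_geq.
have L0 : 0 < L by move: Lam; rewrite ler_norml => /andP[]; lra.
pose c := L^-1 *: \sum_(a <= i < b) eta i *: P i.
have Cc : C c.
  rewrite /c LE; apply: convex_avg => //; last by rewrite -LE.
  move=> i /andP[ai ib]; split => //; apply: hC.
    by rewrite (leq_trans Kk)// (leq_trans ka).
  apply: (le_lt_trans (enorm_trans (z a) _ _)).
  have := zi i; rewrite ai (ltnW ib) => /(_ isT); lra.
exists c => //.
have Lc : L *: c = \sum_(a <= i < b) eta i *: P i.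
  by rewrite /c scalerA mulfV ?scale1r// gt_eqF.
have cM : enorm c <= M.
  rewrite -(ler_pM2l L0) -{1}(ger0_norm (ltW L0)) -enormZ Lc.
  apply: (le_trans (enorm_sum _ _ _)); rewrite LE mulr_suml.
  by apply: ler_sum => i _; rewrite enormZ ger0_norm// ler_wpM2l.
have xis : enorm (\sum_(a <= i < b) xi i) <= e * s / 8.
  apply: (le_trans (enorm_sum _ _ _)).
  apply: (@le_trans _ _ (series th b - series th a)).
    by rewrite sub_series_geq//; apply: ler_sum.
  by apply: ltW; apply: N3P => //; exact: leq_trans ka.
have zab := iterate_sum ab; rewrite -Lc in zab.
have dps : enorm (zeta (s0 + s) - zeta s0 - s *: p) <= e / 4 * s.
  by have := dP s; rewrite gtr0_norm//; apply.
rewrite -(ler_pM2l s_gt0) -{1}(gtr0_norm s_gt0) -enormZ.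
(* Error budget: e s / 4 from the chord, and e s / 8 from each of the two end points, the gap s - L
   and the perturbations. *)
have -> : s *: (p + c) = - (zeta (s0 + s) - zeta s0 - s *: p)
   - (z b - zeta (s0 + s)) + (z a - zeta s0) + ((s - L) *: c + \sum_(a <= i < b) xi i).
  move: zab => /eqP; rewrite subr_eq => /eqP->.
  by clearbody c; apply/matrixP => i j; rewrite !mxE; ring.
apply: (le_trans (enormD _ _)).
have h1 := enormD (- (zeta (s0 + s) - zeta s0 - s *: p) - (z b - zeta (s0 + s))) (z a - zeta s0).
have h2 := enormB (- (zeta (s0 + s) - zeta s0 - s *: p)) (z b - zeta (s0 + s)).
rewrite [enorm (- (zeta (s0 + s) - zeta s0 - s *: p))]enormN in h2.
have h3 := enormD ((s - L) *: c) (\sum_(a <= i < b) xi i).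
rewrite enormZ in h3.
have h4 : `|s - L| * enorm c <= e2 * M.
  by apply: ler_pM => //; [exact: enorm_ge0|rewrite distrC].
have : e / 4 * s = e * s / 4 by ring.
lra.
Qed.

End Discrete.

(** * Velocities and symmetry of the Hessian *)

Section Velocity.
Variable R : realType.

Lemma is_derive_eps (F : R -> R) (t q : R) :
  (forall e, 0 < e -> exists2 d, 0 < d &
     forall s, `|s| < d -> `|F (t + s) - F t - s * q| <= e * `|s|) ->
  is_derive t 1 F q.
Proof.
move=> h.
have c : h^-1 *: (F (h *: 1 + t) - F t) @[h --> 0^'] --> q.
  apply/cvgrPdist_le => e e0; have [d d0 dP] := h _ e0.
  exists d => //= s; rewrite /ball/= sub0r normrN => sd s0.
  have -> : q - s^-1 *: (F (s *: 1 + t) - F t) = - (s^-1 * (F (t + s) - F t - s * q)).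
    by rewrite /GRing.scale/= mulr1 (addrC s); field.
  rewrite normrN normrM normfV ler_pdivrMl ?normr_gt0// [leRHS]mulrC.
  exact: dP.
apply: DeriveDef; first by apply/cvg_ex; exists q.
exact/cvg_lim.
Qed.

Lemma eps_is_derive (F : R -> R) (t q : R) : is_derive t 1 F q ->
  forall e, 0 < e -> exists2 d, 0 < d &
     forall s, `|s| < d -> `|F (t + s) - F t - s * q| <= e * `|s|.
Proof.
move=> [/cvg_ex[l cl] dE] e e0.
have lq : l = q by rewrite -dE; apply/esym/cvg_lim.
rewrite {}lq in cl.
have /cvgrPdist_le/(_ _ e0)[d /= d0 dP] := cl.
exists d => // s sd; have [->|s0] := eqVneq s 0.
  by rewrite addr0 mul0r !subrr normr0 mulr0.
have := dP s; rewrite /ball/= sub0r normrN => /(_ sd s0).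
have -> : q - s^-1 *: (F (s *: 1 + t) - F t) = - (s^-1 * (F (t + s) - F t - s * q)).
  by rewrite /GRing.scale/= mulr1 (addrC s); field.
by rewrite normrN normrM normfV ler_pdivrMl ?normr_gt0// [leRHS]mulrC.
Qed.

Lemma mx_norm_le_enorm m (u : 'cV[R]_m) : `|u| <= enorm u.
Proof.
rewrite [`|u|]mx_normrE.
apply: (big_ind (fun x => x <= enorm u)) => //; first exact: enorm_ge0.
  by move=> a b ha hb; rewrite ge_max ha hb.
by move=> [i j] _ /=; rewrite ord1 coord_le_enorm.
Qed.

Lemma has_vel_derive1 m (c : R -> 'cV[R]_m) t p : has_vel c t p -> derive1 c t = p.
Proof.
move=> h; apply/cvg_lim; first exact: norm_hausdorff.
apply/cvgrPdist_le => e e0; have [d d0 dP] := h _ e0.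
exists d => //= s; rewrite /ball/= sub0r normrN => sd s0.
have -> : p - s^-1 *: (c (s + t) - c t) = - (s^-1 *: (c (t + s) - c t - s *: p)).
  by apply/matrixP => i j; rewrite !mxE (addrC s); field.
have := dP _ sd; set u := c (t + s) - c t - s *: p => hu.
rewrite normrN normrZ normfV ler_pdivrMl ?normr_gt0// [leRHS]mulrC.
exact: le_trans (mx_norm_le_enorm u) hu.
Qed.

Lemma has_vel_coord m (c : R -> 'cV[R]_m) (t : R) (q : 'I_m -> R) :
  (forall i, is_derive t 1 (fun s : R => c s i 0) (q i)) -> has_vel c t (\col_i q i).
Proof.
move=> h e e0.
have e10 : 0 < e / m.+1%:R by rewrite divr_gt0.
have {}h i : exists d, 0 < d /\ forall s, `|s| < d ->
    `|c (t + s) i 0 - c t i 0 - s * q i| <= e / m.+1%:R * `|s|.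
  by have [d d0 dP] := eps_is_derive (h i) e10; exists d.
have [d dP] := choice h.
(* The default 1 keeps the radius positive when there are no coordinates. *)
exists (\big[Num.min/1]_i d i).
  by apply: (big_ind (fun x => 0 < x)) => // [a b a0 b0|i _]; [rewrite lt_min a0|have [] := dP i].
move=> s sd; apply: (le_trans (enorm_le_sum _)).
apply: (@le_trans _ _ (\sum_(i < m) e / m.+1%:R * `|s|)).
  apply: ler_sum => i _; rewrite !mxE; apply: (dP i).2; apply: (lt_le_trans sd).
  by rewrite (bigD1 i)//= ge_min lexx.
rewrite sumr_const card_ord -[_ *+ m]mulr_natr mulrAC ler_wpM2r//.
by rewrite -mulrA ler_piMr ?(ltW e0)// mulrC ler_pdivrMr// mul1r ler_nat.
Qed.

End Velocity.

Section Smooth.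
Variables (R : realType) (m : nat) (g : 'cV[R]_m -> R).
Variables (G : 'cV[R]_m -> 'cV[R]_m) (H : 'cV[R]_m -> 'M[R]_m).
Hypothesis g_grad : has_grad g G.
Hypothesis g_hess : has_jac G H.

Lemma grad_line z v (t : R) : is_derive t 1 (fun s : R => g (z + s *: v)) (dot (G (z + t *: v)) v).
Proof.
apply: is_derive_eps => e e0.
have v0 := enorm_ge0 v.
have e10 : 0 < e / (enorm v + 1) by rewrite divr_gt0//; lra.
have [d d0 dP] := g_grad (z + t *: v) e10.
exists (d / (enorm v + 1)); first by rewrite divr_gt0//; lra.
move=> s sd; have := dP (s *: v); rewrite enormZ dotZr scalerDl addrA.
have h1 : `|s| * enorm v < d.
  move: sd; rewrite ltr_pdivlMr; last lra.
  by apply: le_lt_trans; rewrite ler_wpM2l//; lra.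
move=> /(_ h1) /le_trans; apply.
rewrite mulrAC mulrA ler_pdivrMr; last lra.
by rewrite ler_wpM2l ?mulr_ge0//; [lra..].
Qed.

Lemma jac_bound L z u : (forall z z', enorm (G z - G z') <= L * enorm (z - z')) ->
  enorm (H z *m u) <= L * enorm u.
Proof.
move=> G_lip; apply/ler_addgt0Pr => e e0.
have u0 := enorm_ge0 u.
have e10 : 0 < e / (enorm u + 1) by rewrite divr_gt0//; lra.
have [d d0 dP] := g_hess z e10.
pose s := d / (2 * (enorm u + 1)).
have s0 : 0 < s by rewrite divr_gt0// mulr_gt0//; lra.
have su : s * enorm u < d.
  by rewrite /s mulrAC ltr_pdivrMr ?mulr_gt0; nra.
have h1 := dP (s *: u); rewrite enormZ gtr0_norm// in h1.
have {}h1 := h1 su.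
have h2 := G_lip (z + s *: u) z; rewrite addrAC subrr add0r enormZ gtr0_norm// in h2.
have h3 := enorm_subl (H z *m (s *: u)) (G (z + s *: u) - G z).
rewrite (enormBC (H z *m (s *: u))) -scalemxAr enormZ gtr0_norm// in h3.
rewrite -scalemxAr in h1.
rewrite -(ler_pM2l s0) mulrDr.
have h4 : e / (enorm u + 1) * (s * enorm u) <= s * e.
  rewrite mulrAC ler_pdivrMr; last lra.
  by have := mulr_gt0 s0 e0; lra.
have : L * (s * enorm u) = s * (L * enorm u) by ring.
lra.
Qed.

(* The second difference is symmetric in u and w, hence so is the Hessian. *)
Lemma hess_second_diff (z u w : 'cV[R]_m) (e : R) : 0 < e -> exists2 d, 0 < d & forall s, 0 < s < d ->
  `|g (z + s *: u + s *: w) - g (z + s *: u) - g (z + s *: w) + g z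
     - s ^+ 2 * dot (H z *m u) w| <= s ^+ 2 * e.
Proof.
move=> e0.
pose K := enorm u + enorm w.
have u0 := enorm_ge0 u; have w0 := enorm_ge0 w.
have K0 : 0 <= K by rewrite addr_ge0.
pose e1 := e / (2 * (K + 1) ^+ 2).
have e10 : 0 < e1 by rewrite divr_gt0// mulr_gt0// exprn_gt0//; lra.
have [d d0 dP] := g_hess z e10.
exists (d / (K + 1)); first by rewrite divr_gt0//; lra.
move=> s /andP[s0 sd].
have sK : s * K < d.
  move: sd; rewrite ltr_pdivlMr; last lra.
  by apply: le_lt_trans; rewrite ler_wpM2l ?(ltW s0)//; lra.
(* The mean value theorem in the direction w turns the second difference into a difference of G at z
   + a and z + b with a - b = s u; both values are then expanded at z. *)
pose phi (t : R) : R := g (z + s *: u + t *: (s *: w)) - g (z + t *: (s *: w)).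
pose dphi (t : R) : R := dot (G (z + s *: u + t *: (s *: w))) (s *: w) - dot (G (z + t *: (s *: w))) (s *: w).
have dphiP (t : R) : is_derive t 1 phi (dphi t).
  by apply: is_deriveB; exact: grad_line.
have [|t tI] := @MVT R phi dphi 0 1 ltr01 (fun t _ => dphiP t).
  apply: derivable_within_continuous => t _; exact: (@ex_derive _ _ _ _ _ _ _ (dphiP t)).
rewrite subr0 mulr1 {1 2}/phi !scale1r !scale0r !addr0 => phiE.
have [t0 t1] : 0 <= t /\ t <= 1.
  by move: tI; rewrite in_itv/= => /andP[/ltW ? /ltW ?].
pose a := s *: u + t *: (s *: w); pose b := t *: (s *: w).
have bn : enorm b <= s * enorm w.
  rewrite /b !enormZ (ger0_norm t0) (gtr0_norm s0) -[leRHS]mul1r.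
  by rewrite ler_wpM2r ?mulr_ge0// ltW.
have an : enorm a <= s * K.
  apply: (le_trans (enormD _ _)); rewrite /K mulrDr enormZ (gtr0_norm s0).
  by rewrite lerD2l.
have bn' : enorm b <= s * K.
  by apply: (le_trans bn); rewrite ler_wpM2l ?(ltW s0)// /K lerDr.
have ha := dP a (le_lt_trans an sK).
have hb := dP b (le_lt_trans bn' sK).
have -> : g (z + s *: u + s *: w) - g (z + s *: u) - g (z + s *: w) + g z = dphi t.
  by rewrite -phiE; ring.
have -> : dphi t - s ^+ 2 * dot (H z *m u) w =
   s * dot ((G (z + a) - G z - H z *m a) - (G (z + b) - G z - H z *m b)) w.
  rewrite /dphi /a /b !dotE addrA !mulmxDr -!scalemxAr !dotE; ring.
rewrite normrM (gtr0_norm s0) expr2 -mulrA ler_wpM2l ?(ltW s0)//.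
apply: (le_trans (cauchy_schwarz _ _)).
have h := enormB (G (z + a) - G z - H z *m a) (G (z + b) - G z - H z *m b).
have h1 : enorm (G (z + a) - G z - H z *m a - (G (z + b) - G z - H z *m b)) <= 2 * e1 * (s * K).
  have := ler_wpM2l (ltW e10) an; have := ler_wpM2l (ltW e10) bn'; lra.
apply: (@le_trans _ _ (2 * e1 * (s * K) * K)).
  by apply: ler_pM => //; rewrite ?enorm_ge0// lerDr.
have -> : e = 2 * e1 * (K + 1) ^+ 2.
  by rewrite /e1; field; rewrite gt_eqF//; lra.
have se : 0 <= s * e1 by rewrite mulr_ge0 ?ltW.
by have := mulr_ge0 se K0; lra.
Qed.

Lemma hess_sym z u w : dot (H z *m u) w = dot (H z *m w) u.
Proof.
apply/eqP; rewrite -subr_eq0 -normr_le0; apply/ler_addgt0Pr => e e0.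
have e20 : 0 < e / 2 by rewrite divr_gt0.
have [d1 d10 h1] := hess_second_diff z u w e20.
have [d2 d20 h2] := hess_second_diff z w u e20.
pose s := Num.min d1 d2 / 2.
have mp : 0 < Num.min d1 d2 by rewrite lt_min d10.
have s0 : 0 < s by rewrite divr_gt0.
have sd1 : 0 < s < d1.
  rewrite s0 /=; apply: (@lt_le_trans _ _ (Num.min d1 d2)); first by rewrite /s; lra.
  by rewrite ge_min lexx.
have sd2 : 0 < s < d2.
  rewrite s0 /=; apply: (@lt_le_trans _ _ (Num.min d1 d2)); first by rewrite /s; lra.
  by rewrite ge_min lexx orbT.
have := h1 _ sd1; have := h2 _ sd2.
rewrite (_ : z + s *: w + s *: u = z + s *: u + s *: w); last by rewrite addrAC.
rewrite !ler_norml => /andP[a1 a2] /andP[b1 b2].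
have s2 : 0 < s ^+ 2 by rewrite exprn_gt0.
by apply/andP; split; rewrite -(ler_pM2l s2) add0r; lra.
Qed.

Lemma hess_trmx z : (H z)^T = H z.
Proof.
apply/matrixP => i j; rewrite mxE.
have E (A : 'M[R]_m) a b : A a b = dot (A *m delta_mx b 0) (delta_mx a 0).
  rewrite /dot (bigD1 a)//= big1 ?addr0; last first.
    by move=> k /negbTE ka; rewrite !mxE ka mulr0.
  rewrite -colE !mxE !eqxx mulr1 //.
by rewrite E hess_sym -E.
Qed.

End Smooth.

(** * Closed graphs *)

Section ClosedGraph.
Variables (R : realType) (m : nat) (D : 'cV[R]_m -> set 'cV[R]_m) (Mf : R).
Hypothesis D_closed : closed [set zv : 'cV[R]_m * 'cV[R]_m | D zv.1 zv.2].
Hypothesis D_bound : forall z v, D z v -> enorm v <= Mf.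

(** This replaces the extraction of a subsequence: the sets K N prescribe what must hold along the
    ultrafilter. *)
Lemma ultra_from (K : nat -> set nat) : (forall N, K N !=set0) ->
  (forall i j, (i <= j)%N -> K j `<=` K i) ->
  exists2 U : set_system nat, UltraFilter U & forall N, U (K N).
Proof.
move=> K0 Knd; pose F := filter_from setT K.
have PF : ProperFilter F.
  apply: filter_from_proper => [|N _]; last exact: K0.
  apply: filter_from_filter; first by exists 0%N.
  move=> i j _ _; exists (maxn i j) => // k Kk.
  by split; [apply: Knd Kk; exact: leq_maxl|apply: Knd Kk; exact: leq_maxr].
have [U [UU sU]] := @ultraFilterLemma nat F PF.
by exists U => // N; apply: sU; exists N.
Qed.

Lemma ultra_infty : exists2 U : set_system nat, UltraFilter U & forall N, U [set k | (N <= k)%N].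
Proof.
apply: (@ultra_from (fun N => [set k | (N <= k)%N])) => [N|i j ij k /=]; first by exists N => /=.
exact: leq_trans.
Qed.

Lemma graph_ulim (U : set_system nat) (zs vs : nat -> 'cV[R]_m) z v : UltraFilter U ->
  ulim U zs z -> ulim U vs v -> (forall k, D (zs k) (vs k)) -> D z v.
Proof.
move=> UU hz hv hD.
suff /D_closed : closure [set zv : 'cV[R]_m * 'cV[R]_m | D zv.1 zv.2] (z, v) by [].
move=> B /nbhs_ballP[e /= e0 eB].
have [k /= [h1 h2]] := filter_ex (filterI (hz e e0) (hv e e0)).
exists (zs k, vs k); split; first exact: hD.
apply: eB; split => /=.
- rewrite mx_norm_ball /ball_/=; apply: le_lt_trans h1.
  by rewrite distrC mx_norm_le_enorm.
- rewrite mx_norm_ball /ball_/=; apply: le_lt_trans h2.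
  by rewrite distrC mx_norm_le_enorm.
Qed.

Lemma inv_nat_small (U : set_system nat) (e : R) : UltraFilter U ->
  (forall N, U [set k | (N <= k)%N]) -> 0 < e -> U [set k | k.+1%:R^-1 < e].
Proof.
move=> UU Uoo e0; apply: filterS (Uoo (Num.truncn e^-1)) => k /= hk.
rewrite invf_plt ?posrE//.
by apply: (lt_le_trans (truncnS_gt _)); rewrite ler_nat.
Qed.

(** By compactness: counterexamples at distance 1 / (k + 1) have bounded values, whose ultralimit
    lies in [D z0] by the closed graph. *)
Lemma graph_usc z0 e : 0 < e -> exists2 rho, 0 < rho & forall z v,
  enorm (z - z0) < rho -> D z v -> exists2 v0, D z0 v0 & enorm (v - v0) < e.
Proof.
move=> e0; apply: contrapT => hn.
have h (k : nat) : exists zv : 'cV[R]_m * 'cV[R]_m, enorm (zv.1 - z0) < k.+1%:R^-1 /\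
    D zv.1 zv.2 /\ forall v0, D z0 v0 -> ~ enorm (zv.2 - v0) < e.
  apply: contrapT => hk; apply: hn; exists k.+1%:R^-1; first by rewrite invr_gt0.
  move=> z v zz0 Dzv; apply: contrapT => hv; apply: hk; exists (z, v); split => //; split => //.
  by move=> v0 Dv0 vv0; apply: hv; exists v0.
have [zv zvP] := choice h.
have [U UU Uoo] := ultra_infty.
have [v vP] : exists v, ulim U (fun k => (zv k).2) v.
  by apply: (@ulim_exists _ _ UU _ _ Mf) => k; exact: D_bound (zvP k).2.1.
have Dv : D z0 v.
  apply: (graph_ulim UU _ vP (fun k => (zvP k).2.1)) => a a0.
  apply: filterS (inv_nat_small UU Uoo a0) => k /=; exact: lt_trans (zvP k).1.
have [k /= hk] := filter_ex (vP _ e0).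
exact: (zvP k).2.2 v Dv hk.
Qed.

End ClosedGraph.

Lemma lipschitz_abs_cont (R : realType) (m : nat) (c : R -> 'cV[R]_m) (L : R) :
  (forall a b, enorm (c a - c b) <= L * `|a - b|) -> abs_cont_curve c.
Proof.
move=> cL e e0.
have L0 : 0 < Num.max L 0 + 1 by rewrite ltr_pwDr// le_max lexx orbT.
exists (e / (Num.max L 0 + 1)); first by rewrite divr_gt0.
move=> K a b hab _; rewrite ltr_pdivlMr// => h; apply: le_lt_trans h.
rewrite mulr_suml; apply: ler_sum => i _.
have [_ [ab _]] := hab i (ltn_ord i).
apply: (le_trans (cL _ _)); rewrite ger0_norm ?subr_ge0// mulrC.
by rewrite ler_wpM2l ?subr_ge0// ler_wpDr// le_max lexx.
Qed.

(** Supplies the convex set for [limit_curve_velocity]: directions at nearby points are only close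
    to those at the base point. L is affine and not linear because the y-block of [dirf z d] does
    not depend on d. *)
Lemma thickened_image_convex (R : realType) (k m : nat) (C : set 'cV[R]_k)
    (L : 'cV[R]_k -> 'cV[R]_m) (e : R) : convex_vset C ->
  (forall a b t, L (t *: a + (1 - t) *: b) = t *: L a + (1 - t) *: L b) ->
  convex_vset [set P | exists2 d, C d & enorm (P - L d) <= e].
Proof.
move=> cC hL a b t [da Cda ha] [db Cdb hb] /andP[t0 t1].
exists (t *: da + (1 - t) *: db); first by apply: cC => //; rewrite t0.
have t1' : 0 <= 1 - t by rewrite subr_ge0.
rewrite hL opprD addrACA -!scalerBr.
apply: (le_trans (enormD _ _)); rewrite !enormZ (ger0_norm t0) (ger0_norm t1').
apply: (le_trans (lerD (ler_wpM2l t0 ha) (ler_wpM2l t1' hb))).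
by rewrite -mulrDl addrC subrK mul1r.
Qed.

(** * The bilevel problem *)

Section Bilevel.
Variables (R : realType) (n p : nat) (f g : 'cV[R]_(n + p) -> R).
Variables (G : 'cV[R]_(n + p) -> 'cV[R]_(n + p)) (H : 'cV[R]_(n + p) -> 'M[R]_(n + p)).
Variables (Mf mu Lg Qg beta betahat : R).
Hypotheses (hMf : 0 < Mf) (hmu : 0 < mu) (hLg : 0 < Lg) (hQg : 0 < Qg).
Hypothesis f_lip : forall z z', `|f z - f z'| <= Mf * enorm (z - z').
Hypothesis g_grad : has_grad g G.
Hypothesis g_hess : has_jac G H.
Hypothesis g_strong : forall z (u : 'cV[R]_p), mu * enorm u ^+ 2 <= dot u (hessyy H z *m u).
Hypothesis G_lip : forall z z', enorm (G z - G z') <= Lg * enorm (z - z').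
Hypothesis Hyy_lip : forall z z', opnorm (hessyy H z - hessyy H z') <= Qg * enorm (z - z').
Hypothesis Hxy_lip : forall z z', opnorm (hessxy H z - hessxy H z') <= Qg * enorm (z - z').

(* With z = (x, y): newton z is the paper's A(x, y), newton_pt z = (x, A(x, y)), and
   - dirf z d is the search direction of the algorithm without inexactness. *)
Definition newton z := dsubmx z - invmx (hessyy H z) *m grady G z.
Definition newton_pt z := col_mx (usubmx z) (newton z).
(** Where the y-gradient of g vanishes, this is minus the adjoint of the derivative of the implicit
    solution map of the lower level. *)
Definition sens z (b : 'cV[R]_p) := hessxy H z *m (invmx (hessyy H z) *m b).
Definition dirf z (d : 'cV[R]_(n + p)) :=
  col_mx (usubmx d - sens z (dsubmx d)) (betahat *: grady G z).
Definition penalty z := beta / 2 * enorm (grady G z) ^+ 2.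

Lemma newton_ptE x y : newton_pt (col_mx x y) = col_mx x (Amap G H x y).
Proof. by rewrite /newton_pt /newton /Amap col_mxKu col_mxKd. Qed.

Lemma hfunE x y : hfun f beta G H x y = f (newton_pt (col_mx x y)) + penalty (col_mx x y).
Proof. by rewrite newton_ptE. Qed.

(** * Bounds on the Hessian blocks, the Newton map and the penalty *)

Lemma hessyy_sym z : (hessyy H z)^T = hessyy H z.
Proof. by rewrite /hessyy trmx_drsub (hess_trmx g_grad g_hess). Qed.

Lemma grady_jac z (u : 'cV[R]_(n + p)) :
  dsubmx (H z *m u) = (hessxy H z)^T *m usubmx u + hessyy H z *m dsubmx u.
Proof.
rewrite /hessxy /hessyy trmxK -{1}(vsubmxK u) -{1}(submxK (H z)) mul_block_col.
by rewrite col_mxKd.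
Qed.

Lemma hessyy_bound z u : enorm (hessyy H z *m u) <= Lg * enorm u.
Proof.
have := grady_jac z (col_mx 0 u); rewrite col_mxKu col_mxKd mulmx0 add0r => <-.
apply: (le_trans (enorm_dsubmx _)); apply: (le_trans (jac_bound g_hess _ _ G_lip)).
by rewrite enorm_col_0mx.
Qed.

Lemma hessxyT_bound z u : enorm ((hessxy H z)^T *m u) <= Lg * enorm u.
Proof.
have := grady_jac z (col_mx u 0); rewrite col_mxKu col_mxKd mulmx0 addr0 => <-.
apply: (le_trans (enorm_dsubmx _)); apply: (le_trans (jac_bound g_hess _ _ G_lip)).
by rewrite enorm_col_mx0.
Qed.

(** The Jacobian of G bounds the transposed block; duality transfers the bound. *)
Lemma hessxy_bound z u : enorm (hessxy H z *m u) <= Lg * enorm u.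
Proof.
set a := hessxy H z *m u.
have [a0|a0] := eqVneq (enorm a) 0; first by rewrite a0 mulr_ge0 ?enorm_ge0 ?ltW.
have ap : 0 < enorm a by rewrite lt_neqAle eq_sym a0 enorm_ge0.
rewrite -(ler_pM2l ap) -expr2 enorm_sqr {2}/a dot_mulmx.
apply: (le_trans (dot_le _ _)); rewrite mulrCA mulrA.
by rewrite ler_wpM2r ?enorm_ge0// hessxyT_bound.
Qed.

Lemma hessyy_coercive z u : mu * enorm u <= enorm (hessyy H z *m u).
Proof.
have [u0|u0] := eqVneq (enorm u) 0; first by rewrite u0 mulr0 enorm_ge0.
have up : 0 < enorm u by rewrite lt_neqAle eq_sym u0 enorm_ge0.
rewrite -(ler_pM2l up); apply: le_trans (dot_le _ _); apply: le_trans (g_strong z u).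
by rewrite mulrCA expr2.
Qed.

Lemma hessyy_unit z : hessyy H z \in unitmx.
Proof.
apply: unitmx_inj => u Hu; apply: enorm_eq0; apply/eqP.
have := hessyy_coercive z u; rewrite Hu enorm0 pmulr_rle0// => u0.
by rewrite eq_le u0 enorm_ge0.
Qed.

Lemma invhess_bound z u : enorm (invmx (hessyy H z) *m u) <= enorm u / mu.
Proof.
rewrite ler_pdivlMr// mulrC; apply: (le_trans (hessyy_coercive z _)).
by rewrite mulKVmx ?hessyy_unit.
Qed.

Lemma invhess_lip z z' u :
  enorm (invmx (hessyy H z) *m u - invmx (hessyy H z') *m u) <=
  Qg / mu ^+ 2 * enorm (z - z') * enorm u.
Proof.
(* Resolvent identity: the difference of two inverses is one inverse times the difference of the
   matrices times the other. *)
have -> : invmx (hessyy H z) *m u - invmx (hessyy H z') *m u =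
    invmx (hessyy H z) *m ((hessyy H z' - hessyy H z) *m (invmx (hessyy H z') *m u)).
  by rewrite mulmxBl mulKVmx ?hessyy_unit// mulmxBr mulKmx ?hessyy_unit.
apply: (le_trans (invhess_bound _ _)).
have h := opnorm_le (invmx (hessyy H z') *m u) (Hyy_lip z' z).
have h2 := invhess_bound z' u.
rewrite ler_pdivrMr//; apply: (le_trans h).
rewrite enormBC.
have := ler_wpM2l (mulr_ge0 (ltW hQg) (enorm_ge0 (z - z'))) h2 => /le_trans; apply.
rewrite le_eqVlt; apply/orP; left; apply/eqP; field; rewrite gt_eqF//.
Qed.

Lemma grady_lip z z' : enorm (grady G z - grady G z') <= Lg * enorm (z - z').
Proof.
apply: le_trans (G_lip z z'); apply: le_trans (enorm_dsubmx _).
by rewrite /grady linearB.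
Qed.

Lemma grady_bound z : enorm (grady G z) <= enorm (grady G 0) + Lg * enorm z.
Proof.
apply: (le_trans (enorm_subl _ (grady G 0))); rewrite lerD2l.
by apply: (le_trans (grady_lip _ _)); rewrite subr0.
Qed.

Lemma sens_bound z b : enorm (sens z b) <= Lg / mu * enorm b.
Proof.
apply: (le_trans (hessxy_bound _ _)); rewrite -mulrA ler_wpM2l ?(ltW hLg)//.
by rewrite mulrC invhess_bound.
Qed.

Lemma sensB z a b : sens z (a - b) = sens z a - sens z b.
Proof. by rewrite /sens !mulmxBr. Qed.

Lemma sens_lip z z' b : enorm (sens z b - sens z' b) <=
  (Qg / mu + Lg * (Qg / mu ^+ 2)) * enorm (z - z') * enorm b.
Proof.
have -> : sens z b - sens z' b = (hessxy H z - hessxy H z') *m (invmx (hessyy H z) *m b)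
   + hessxy H z' *m (invmx (hessyy H z) *m b - invmx (hessyy H z') *m b).
  by rewrite /sens mulmxBl mulmxBr addrA subrK.
apply: (le_trans (enormD _ _)); rewrite -!mulrA mulrDl; apply: lerD.
  apply: (le_trans (opnorm_le _ (Hxy_lip z z'))).
  rewrite -!mulrA ler_wpM2l ?(ltW hQg)// [leRHS]mulrCA ler_wpM2l ?enorm_ge0//.
  by rewrite mulrC invhess_bound.
apply: (le_trans (hessxy_bound _ _)); rewrite -!mulrA ler_wpM2l ?(ltW hLg)//.
by have := invhess_lip z z' b; rewrite !mulrA.
Qed.

Lemma sens_lip_ex : exists2 C, 0 <= C & forall z z' b,
  enorm (sens z b - sens z' b) <= C * enorm (z - z') * enorm b.
Proof.
exists (Qg / mu + Lg * (Qg / mu ^+ 2)); last exact: sens_lip.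
have h : 0 <= Qg / mu ^+ 2 by rewrite divr_ge0 ?exprn_ge0 ?ltW.
exact: addr_ge0 (divr_ge0 (ltW hQg) (ltW hmu)) (mulr_ge0 (ltW hLg) h).
Qed.

(** Symmetry of the yy-block turns the derivative of the Newton map in x into the correction [sens]
    of the search direction. *)
Lemma dot_sens z a b :
  dot (invmx (hessyy H z) *m ((hessxy H z)^T *m a)) b = dot a (sens z b).
Proof.
rewrite dotC dot_mulmx trmx_inv hessyy_sym dot_mulmx trmxK.
by rewrite dotC.
Qed.

(** The bound is local because the variation of the inverse Hessian is multiplied by the y-gradient,
    which may grow linearly. *)
Lemma newton_lip B : exists2 C, 0 <= C & forall z z', enorm z <= B -> enorm z' <= B ->
  enorm (newton z - newton z') <= C * enorm (z - z').
Proof.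
pose rB := enorm (grady G 0) + Lg * `|B|.
have rB0 : 0 <= rB by rewrite addr_ge0 ?enorm_ge0// mulr_ge0 ?(ltW hLg).
have k0 : 0 <= Qg / mu ^+ 2 by rewrite divr_ge0 ?exprn_ge0 ?ltW.
have l0 : 0 <= Lg / mu by rewrite divr_ge0 ?ltW.
exists (1 + Lg / mu + Qg / mu ^+ 2 * rB).
  by rewrite !addr_ge0// mulr_ge0.
move=> z z' zB zB'.
have -> : newton z - newton z' = dsubmx (z - z')
   - invmx (hessyy H z) *m (grady G z - grady G z')
   - (invmx (hessyy H z) *m grady G z' - invmx (hessyy H z') *m grady G z').
  rewrite /newton linearB mulmxBr.
  by apply/matrixP => i j; rewrite !mxE; ring.
apply: (le_trans (enormB _ _)).
have h1 := enormB (dsubmx (z - z')) (invmx (hessyy H z) *m (grady G z - grady G z')).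
have h2 := enorm_dsubmx (z - z').
have h3 := invhess_bound z (grady G z - grady G z').
have h4 : enorm (grady G z - grady G z') / mu <= Lg / mu * enorm (z - z').
  by rewrite mulrAC ler_pM2r ?invr_gt0// grady_lip.
have h5 := invhess_lip z z' (grady G z').
have h6 : Qg / mu ^+ 2 * enorm (z - z') * enorm (grady G z') <=
    Qg / mu ^+ 2 * rB * enorm (z - z').
  rewrite -[leRHS]mulrA -[leLHS]mulrA ler_wpM2l// mulrC ler_wpM2r ?enorm_ge0//.
  apply: (le_trans (grady_bound _)); rewrite lerD2l ler_wpM2l ?(ltW hLg)//.
  exact: le_trans zB' (ler_norm _).
lra.
Qed.

Lemma newton_pt_lip B : exists2 C, 0 <= C & forall z z', enorm z <= B -> enorm z' <= B ->
  enorm (newton_pt z - newton_pt z') <= C * enorm (z - z').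
Proof.
have [C C0 CP] := newton_lip B; exists (1 + C); first by rewrite addr_ge0.
move=> z z' zB z'B; rewrite /newton_pt opp_col_mx add_col_mx -linearB.
apply: (le_trans (enorm_col_mx _ _)); have := CP _ _ zB z'B.
by have := enorm_usubmx (z - z'); lra.
Qed.

Lemma penalty_lip B : exists2 C, 0 <= C & forall z z', enorm z <= B -> enorm z' <= B ->
  `|penalty z - penalty z'| <= C * enorm (z - z').
Proof.
pose rB := enorm (grady G 0) + Lg * `|B|.
have rB0 : 0 <= rB by rewrite addr_ge0 ?enorm_ge0// mulr_ge0 ?(ltW hLg).
exists (`|beta / 2| * (Lg * (2 * rB))); first by rewrite mulr_ge0// mulr_ge0 ?mulr_ge0 ?(ltW hLg).
have hr z : enorm z <= B -> enorm (grady G z) <= rB.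
  move=> zB; apply: (le_trans (grady_bound _)); rewrite lerD2l ler_wpM2l ?(ltW hLg)//.
  exact: le_trans zB (ler_norm _).
move=> z z' zB z'B; rewrite /penalty -mulrBr normrM -mulrA ler_wpM2l//.
rewrite subr_sqr normrM.
have -> : Lg * (2 * rB) * enorm (z - z') = Lg * enorm (z - z') * (2 * rB) by ring.
apply: ler_pM => //.
  by apply: (le_trans (enorm_lip _ _)); exact: grady_lip.
by rewrite ger0_norm ?addr_ge0 ?enorm_ge0//; have := hr _ zB; have := hr _ z'B; lra.
Qed.

Lemma lyap_lip B : exists2 C, 0 <= C & forall z z', enorm z <= B -> enorm z' <= B ->
  `|(f (newton_pt z) + penalty z) - (f (newton_pt z') + penalty z')| <= C * enorm (z - z').
Proof.
have [C1 C10 h1] := newton_pt_lip B; have [C2 C20 h2] := penalty_lip B.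
exists (Mf * C1 + C2); first by rewrite addr_ge0// mulr_ge0// ltW.
move=> z z' zB z'B.
have -> : (f (newton_pt z) + penalty z) - (f (newton_pt z') + penalty z') =
  (f (newton_pt z) - f (newton_pt z')) + (penalty z - penalty z') by ring.
apply: (le_trans (ler_normD _ _)); rewrite mulrDl; apply: lerD; last exact: h2.
by apply: (le_trans (f_lip _ _)); rewrite -mulrA ler_wpM2l ?(ltW hMf)//; exact: h1.
Qed.

(** f is not expanded: the displacement of the Newton point is paired with an arbitrary bounded
    [d0], later an element of the field. The inverse Hessian is only used as a Lipschitz map, so its
    variation appears as a norm bound proportional to the y-gradient. *)
Lemma expansion z0 e : 0 <= beta -> 0 < e -> exists2 rho, 0 < rho &
  forall dlt d0, enorm dlt < rho -> enorm d0 <= Mf ->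
  dot (newton_pt (z0 + dlt) - newton_pt z0) d0 + (penalty (z0 + dlt) - penalty z0) <=
  dot (usubmx dlt) (usubmx d0 - sens z0 (dsubmx d0))
  + Mf * (Qg / mu ^+ 2) * enorm (grady G z0) * enorm dlt
  + beta * dot (grady G z0) ((hessxy H z0)^T *m usubmx dlt + hessyy H z0 *m dsubmx dlt)
  + e * enorm dlt.
Proof.
move=> b0 e0.
set r0 := grady G z0; set Q := Qg / mu ^+ 2.
have Q0 : 0 <= Q by rewrite divr_ge0 ?exprn_ge0 ?ltW.
have nr0 := enorm_ge0 r0.
have hMf0 := ltW hMf; have hLg0 := ltW hLg.
(* [a] collects the coefficients of the Taylor remainder of the y-gradient, [b] those of the terms
   quadratic in the displacement. *)
pose a := Mf / mu + beta * enorm r0; pose b := Mf * Q * Lg + beta * Lg ^+ 2.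
have a0 : 0 <= a by rewrite addr_ge0 ?mulr_ge0// ?invr_ge0 ltW.
have bb0 : 0 <= b.
  exact: (addr_ge0 (mulr_ge0 (mulr_ge0 hMf0 Q0) hLg0) (mulr_ge0 b0 (exprn_ge0 2 hLg0))).
pose e1 := e / (a + b + 1).
have e10 : 0 < e1 by rewrite divr_gt0//; lra.
have e1E : (a + b) * e1 <= e.
  by rewrite /e1 mulrCA ler_piMr ?(ltW e0)// ler_pdivrMr; lra.
have [d dp dP] := g_hess z0 e10.
exists (Num.min d e1); first by rewrite lt_min dp.
move=> dlt d0; rewrite lt_min => /andP[dd de1] d0M.
set z' := z0 + dlt; set r' := grady G z'.
set N := enorm dlt in dd de1 *.
have N0 : 0 <= N by exact: enorm_ge0.
set w0 := (hessxy H z0)^T *m usubmx dlt + hessyy H z0 *m dsubmx dlt.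
pose rr := r' - r0 - w0.
have rrN : enorm rr <= e1 * N.
  apply: le_trans (dP _ dd); apply: le_trans (enorm_dsubmx _).
  by rewrite !linearB/= grady_jac.
have zz : enorm (z' - z0) = N by rewrite /z' addrAC subrr add0r.
have rrL : enorm (r' - r0) <= Lg * N by rewrite -zz grady_lip.
(* The inverse Hessian applied to the yy-part of the increment gives back the y-displacement, which
   cancels. *)
have nE : newton z' - newton z0 = - (invmx (hessyy H z0) *m ((hessxy H z0)^T *m usubmx dlt))
   - (invmx (hessyy H z0) *m rr
   + (invmx (hessyy H z') *m (r' - r0) - invmx (hessyy H z0) *m (r' - r0))
   + (invmx (hessyy H z') *m r0 - invmx (hessyy H z0) *m r0)).
  rewrite /rr /w0 !(mulmxBr, mulmxDr) mulKmx ?hessyy_unit// /newton -/r0 -/r' /z' linearD/=.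
  by apply/matrixP => i j; rewrite !mxE; ring.
have dE : newton_pt z' - newton_pt z0 = col_mx (usubmx dlt) (newton z' - newton z0).
  by rewrite /newton_pt opp_col_mx add_col_mx /z' linearD/= addrAC subrr add0r.
have -> : dot (newton_pt z' - newton_pt z0) d0 =
   dot (usubmx dlt) (usubmx d0 - sens z0 (dsubmx d0))
   - dot (invmx (hessyy H z0) *m rr
   + (invmx (hessyy H z') *m (r' - r0) - invmx (hessyy H z0) *m (r' - r0))
   + (invmx (hessyy H z') *m r0 - invmx (hessyy H z0) *m r0)) (dsubmx d0).
  rewrite dE -{1}(vsubmxK d0) dot_col_mx nE dotDl dotNl dot_sens dotNl dotDr dotNr; ring.
set E := (X in - dot X _).
have E_le : enorm E <= e1 * N / mu + Q * N * (Lg * N) + Q * N * enorm r0.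
  apply: (le_trans (enormD _ _)); apply: lerD; last first.
    by rewrite -zz; exact: invhess_lip.
  apply: (le_trans (enormD _ _)); apply: lerD.
    apply: (le_trans (invhess_bound _ _)); rewrite ler_pM2r ?invr_gt0//.
  apply: (le_trans (invhess_lip _ _ _)); rewrite zz ler_wpM2l// mulr_ge0//.
have dE_le : - dot E (dsubmx d0) <= Mf * (e1 * N / mu + Q * N * (Lg * N) + Q * N * enorm r0).
  rewrite -dotNl; apply: (le_trans (dot_le _ _)); rewrite enormN mulrC.
  apply: ler_pM => //; rewrite ?enorm_ge0//.
  exact: le_trans (enorm_dsubmx _) d0M.
have pE : penalty z' - penalty z0 = beta * dot r0 w0 + beta * dot r0 rr
    + beta / 2 * enorm (r' - r0) ^+ 2.
  rewrite /penalty -/r' -/r0 !enorm_sqr.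
  have -> : dot r0 w0 = dot r0 r' - dot r0 r0 - dot r0 rr.
    by rewrite /rr !dotE; ring.
  by rewrite !dotE (dotC r' r0); lra.
have p1 : beta * dot r0 rr <= beta * (enorm r0 * (e1 * N)).
  rewrite ler_wpM2l//; apply: (le_trans (dot_le _ _)); rewrite ler_wpM2l//.
have p2 : beta / 2 * enorm (r' - r0) ^+ 2 <= beta * Lg ^+ 2 * N * e1.
  apply: (@le_trans _ _ (beta * (Lg * N) ^+ 2)).
    apply: ler_pM; rewrite ?divr_ge0 ?exprn_ge0 ?enorm_ge0//; first lra.
    by rewrite ler_sqr ?nnegrE ?mulr_ge0 ?enorm_ge0.
  rewrite exprMn mulrA -[leRHS]mulrA ler_wpM2l ?mulr_ge0 ?exprn_ge0//.
  by rewrite expr2 ler_wpM2l// ltW.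
have p3 : Mf * (Q * N * (Lg * N)) <= Mf * Q * Lg * N * e1.
  have -> : Mf * (Q * N * (Lg * N)) = Mf * Q * Lg * N * N by ring.
  exact: ler_wpM2l (mulr_ge0 (mulr_ge0 (mulr_ge0 hMf0 Q0) hLg0) N0) _ _ (ltW de1).
have p4 := ler_wpM2r N0 e1E.
have p5 : (a + b) * e1 * N = Mf * (e1 * N / mu) + beta * (enorm r0 * (e1 * N))
   + Mf * Q * Lg * N * e1 + beta * Lg ^+ 2 * N * e1.
  by rewrite /a /b; field; rewrite gt_eqF.
rewrite pE; lra.
Qed.

(** Put a = |u| and q = beta Lg |r|. Per unit of s, apart from errors in e, the terms are -a^2, a
    cross term of at most (5/4) q a, and three quarters of the penalty term, at most -6 q^2. Their
    sum is at most -a^2 / 2 - 5 q^2 because a^2 / 2 - (5/4) q a + q^2 is nonnegative. *)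
Lemma descent z0 dlt d0 s e : 4 * Qg * Mf / mu ^+ 3 <= beta ->
  beta * (8 * Lg ^+ 2 / mu) <= betahat -> 0 < s -> 0 <= e <= 1 ->
  enorm (dlt + s *: dirf z0 d0) <= e * s -> enorm d0 <= Mf ->
  dot (usubmx dlt) (usubmx d0 - sens z0 (dsubmx d0))
  + Mf * (Qg / mu ^+ 2) * enorm (grady G z0) * enorm dlt
  + beta * dot (grady G z0) ((hessxy H z0)^T *m usubmx dlt + hessyy H z0 *m dsubmx dlt)
  + e * enorm dlt <=
  s * (- (enorm (usubmx d0 - sens z0 (dsubmx d0)) ^+ 2 / 2
          + 5 * (beta * Lg * enorm (grady G z0)) ^+ 2)
       + e * (2 * ((1 + Lg / mu) * Mf)
          + (beta * mu / 4 + 2 * (beta * Lg) + betahat) * enorm (grady G z0) + 1)).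
Proof.
move=> hb hbh s0 /andP[e0 e1] hd d0M.
have b0 : 0 <= beta.
  apply: le_trans hb; rewrite divr_ge0 ?exprn_ge0 ?mulr_ge0 ?ltW//.
have bh0 : 0 <= betahat.
  apply: le_trans hbh; rewrite mulr_ge0// divr_ge0 ?mulr_ge0 ?exprn_ge0 ?ltW//.
have s0' := ltW s0.
set u := usubmx d0 - sens z0 (dsubmx d0) in hd *; set r := grady G z0 in hd *.
have uM : enorm u <= (1 + Lg / mu) * Mf.
  apply: (le_trans (enormB _ _)); rewrite mulrDl mul1r; apply: lerD.
    exact: le_trans (enorm_usubmx _) d0M.
  apply: (le_trans (sens_bound _ _)); rewrite ler_wpM2l ?divr_ge0 ?(ltW hLg) ?(ltW hmu)//.
  exact: le_trans (enorm_dsubmx _) d0M.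
pose ax := usubmx dlt + s *: u; pose ay := dsubmx dlt + s *: (betahat *: r).
have aE : dlt + s *: dirf z0 d0 = col_mx ax ay.
  by rewrite /dirf -/u -/r scale_col_mx -{1}(vsubmxK dlt) add_col_mx.
have axe : enorm ax <= e * s.
  by apply: le_trans hd; rewrite aE; apply: le_trans (enorm_usubmx _); rewrite col_mxKu.
have aye : enorm ay <= e * s.
  by apply: le_trans hd; rewrite aE; apply: le_trans (enorm_dsubmx _); rewrite col_mxKd.
have dxE : usubmx dlt = ax - s *: u by rewrite /ax addrK.
have dyE : dsubmx dlt = ay - (s * betahat) *: r by rewrite /ay scalerA addrK.
set nu := enorm u in uM *; set nr := enorm r.
have nu0 : 0 <= nu by exact: enorm_ge0.
have nr0 : 0 <= nr by exact: enorm_ge0.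
have dn : enorm dlt <= e * s + s * (nu + betahat * nr).
  have := enorm_subl dlt (- (s *: dirf z0 d0)); rewrite opprK enormN enormZ (gtr0_norm s0).
  have : enorm (dirf z0 d0) <= nu + betahat * nr.
    by apply: (le_trans (enorm_col_mx _ _)); rewrite enormZ (ger0_norm bh0).
  by move=> /(ler_wpM2l s0'); lra.
have T1 : dot (usubmx dlt) u <= e * s * nu - s * nu ^+ 2.
  rewrite dxE dotDl dotNl dotZl -enorm_sqr -/nu lerD2r.
  by apply: (le_trans (dot_le _ _)); rewrite ler_wpM2r.
(* The lower bound on beta enters here: the variation of the inverse Hessian consumes a quarter of
   the decrease of the penalty in r. *)
have K1 : Mf * (Qg / mu ^+ 2) <= beta * mu / 4.
  have := ler_wpM2r (ltW hmu) hb.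
  have -> : 4 * Qg * Mf / mu ^+ 3 * mu = 4 * (Mf * (Qg / mu ^+ 2)) by field; rewrite gt_eqF.
  lra.
have mur : mu * nr <= Lg * nr by apply: (le_trans (hessyy_coercive z0 r)); exact: hessyy_bound.
have T2 : Mf * (Qg / mu ^+ 2) * nr * enorm dlt <=
    beta * mu / 4 * nr * (e * s + s * (nu + betahat * nr)).
  have K10 : 0 <= Mf * (Qg / mu ^+ 2).
    exact: mulr_ge0 (ltW hMf) (divr_ge0 (ltW hQg) (exprn_ge0 _ (ltW hmu))).
  apply: ler_pM => //; rewrite ?enorm_ge0//; first exact: mulr_ge0.
  by rewrite ler_wpM2r.
have T3 : beta * dot r ((hessxy H z0)^T *m usubmx dlt) <=
    beta * (nr * (Lg * (e * s))) + s * (beta * (nr * (Lg * nu))).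
  rewrite dxE mulmxBr -scalemxAr dotDr dotNr dotZr mulrDr lerD//.
    rewrite ler_wpM2l//; apply: (le_trans (dot_le _ _)); rewrite ler_wpM2l//.
    by apply: (le_trans (hessxyT_bound _ _)); rewrite ler_wpM2l// ltW.
  rewrite -mulrN mulrCA ler_wpM2l// ler_wpM2l// -dotNr.
  by apply: (le_trans (dot_le _ _)); rewrite ler_wpM2l// enormN hessxyT_bound.
have T4 : beta * dot r (hessyy H z0 *m dsubmx dlt) <=
    beta * (nr * (Lg * (e * s))) - s * (beta * betahat * (mu * nr ^+ 2)).
  rewrite dyE mulmxBr -scalemxAr dotDr dotNr dotZr mulrDr lerD//.
    rewrite ler_wpM2l//; apply: (le_trans (dot_le _ _)); rewrite ler_wpM2l//.
    by apply: (le_trans (hessyy_bound _ _)); rewrite ler_wpM2l// ltW.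
  rewrite mulrN lerN2.
  have := ler_wpM2l (mulr_ge0 (mulr_ge0 b0 bh0) s0') (g_strong z0 r); rewrite -/nr; lra.
have T5 : e * enorm dlt <= e * (s + s * (nu + betahat * nr)).
  rewrite ler_wpM2l//; apply: (le_trans dn); rewrite lerD2r.
  by rewrite -[leRHS]mul1r ler_wpM2r.
have q1 : s * (beta * (nr * (mu * nu))) <= s * (beta * (nr * (Lg * nu))).
  have := ler_wpM2l (mulr_ge0 (mulr_ge0 s0' b0) nu0) mur; lra.
have q2 : 8 * (s * (beta * Lg * nr) ^+ 2) <= s * (beta * betahat * (mu * nr ^+ 2)).
  have h : 8 * (beta * Lg ^+ 2) <= betahat * mu.
    have := ler_wpM2r (ltW hmu) hbh.
    by have -> : beta * (8 * Lg ^+ 2 / mu) * mu = 8 * (beta * Lg ^+ 2) by field; rewrite gt_eqF.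
  have := ler_wpM2l (mulr_ge0 (mulr_ge0 s0' b0) (sqr_ge0 nr)) h; lra.
have q3 : 0 <= s * (nu ^+ 2 / 2 - 5 / 4 * (beta * Lg * nr) * nu + (beta * Lg * nr) ^+ 2).
  rewrite mulr_ge0//.
  have := sqr_ge0 (nu - 5 / 4 * (beta * Lg * nr)); have := sqr_ge0 (beta * Lg * nr); lra.
have q4 : e * s * nu <= e * s * ((1 + Lg / mu) * Mf) by rewrite ler_wpM2l// mulr_ge0.
have T34 : beta * dot r ((hessxy H z0)^T *m usubmx dlt + hessyy H z0 *m dsubmx dlt) =
    beta * dot r ((hessxy H z0)^T *m usubmx dlt) + beta * dot r (hessyy H z0 *m dsubmx dlt).
  by rewrite dotDr mulrDr.
rewrite T34; lra.
Qed.

Hypothesis hbeta : 4 * Qg * Mf / mu ^+ 3 <= beta.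
Hypothesis hbetahat : beta * (8 * Lg ^+ 2 / mu) <= betahat.

Lemma beta_gt0 : 0 < beta.
Proof. by apply: lt_le_trans hbeta; rewrite divr_gt0 ?exprn_gt0// !mulr_gt0. Qed.

Lemma betahat_ge0 : 0 <= betahat.
Proof.
apply: le_trans hbetahat; rewrite mulr_ge0 ?(ltW beta_gt0)//.
by rewrite divr_ge0 ?mulr_ge0 ?exprn_ge0 ?ltW.
Qed.

(** * Search directions drawn from the conservative field *)

Variable D : 'cV[R]_(n + p) -> set 'cV[R]_(n + p).
Hypothesis D_closed : closed [set zv : 'cV[R]_(n + p) * 'cV[R]_(n + p) | D zv.1 zv.2].
Hypothesis D_convex : forall z, convex_vset (D z).
Hypothesis D_bound : forall z v, D z v -> enorm v <= Mf.
Hypothesis f_pot : potential_of f D.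

Lemma dirf_comb z a b t : dirf z (t *: a + (1 - t) *: b) = t *: dirf z a + (1 - t) *: dirf z b.
Proof.
rewrite /dirf !scale_col_mx add_col_mx; congr col_mx.
  rewrite !linearD !linearZ/= /sens !mulmxDr -!scalemxAr.
  move: (hessxy _ _ *m _) (hessxy _ _ *m _) => u v.
  by apply/matrixP => i j; rewrite !mxE; ring.
by rewrite -scalerDl addrCA subrr addr0 scale1r.
Qed.

Lemma dirf_set_convex z e :
  convex_vset [set P | exists2 d0, D (newton_pt z) d0 & enorm (P - dirf z d0) <= e].
Proof. by apply: thickened_image_convex => // a b t; exact: dirf_comb. Qed.

Lemma dirf_bound z d : enorm d <= Mf ->
  enorm (dirf z d) <= (1 + Lg / mu) * Mf + betahat * enorm (grady G z).
Proof.
move=> dM; apply: (le_trans (enorm_col_mx _ _)); rewrite enormZ (ger0_norm betahat_ge0) lerD2r.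
apply: (le_trans (enormB _ _)); rewrite mulrDl mul1r; apply: lerD.
  exact: le_trans (enorm_usubmx _) dM.
apply: (le_trans (sens_bound _ _)); rewrite ler_wpM2l ?divr_ge0 ?(ltW hLg) ?(ltW hmu)//.
exact: le_trans (enorm_dsubmx _) dM.
Qed.

(** The field is evaluated at a point [zz] near the Newton point because the algorithm solves for
    the Newton step inexactly. *)
Lemma dirf_near z0 e : 0 < e -> exists2 rho, 0 < rho & forall z zz d,
  enorm (z - z0) < rho -> enorm (zz - newton_pt z) < rho -> D zz d ->
  exists2 d0, D (newton_pt z0) d0 & enorm (dirf z d - dirf z0 d0) <= e.
Proof.
move=> e0; have bh0 := betahat_ge0; have Mf0 := ltW hMf; have Lg0 := ltW hLg.
have [lm lm0 sb] : exists2 lm, 0 <= lm & forall z b, enorm (sens z b) <= lm * enorm b.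
  by exists (Lg / mu); [rewrite divr_ge0 ?ltW|exact: sens_bound].
have [CM CM0 sl] := sens_lip_ex.
have [C C0 hC] := newton_pt_lip (enorm z0 + 1).
have e10 : 0 < e / (2 * (1 + lm)) by rewrite divr_gt0// mulr_gt0// ltr_pwDl.
have [rho1 rho10 h1] := graph_usc D_closed D_bound (newton_pt z0) e10.
clear hbeta hbetahat.
pose K := CM * Mf + betahat * Lg.
have K0 : 0 <= K by rewrite addr_ge0// mulr_ge0.
pose rho := Num.min (Num.min 1 (rho1 / (2 * (C + 1)))) (e / (2 * (K + 1))).
have rho0 : 0 < rho by rewrite !lt_min ltr01 !divr_gt0//= mulr_gt0// ltr_wpDl.
have rho_1 : rho <= 1 by rewrite !ge_min lexx.
have rho_2 : rho * (2 * (C + 1)) <= rho1.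
  by rewrite -ler_pdivlMr ?mulr_gt0 ?ltr_wpDl// !ge_min lexx orbT.
have rho_3 : rho * (2 * (K + 1)) <= e.
  by rewrite -ler_pdivlMr ?mulr_gt0 ?ltr_wpDl// !ge_min lexx orbT.
exists rho => // z zz d zz0 zzn Dd.
have zB : enorm z <= enorm z0 + 1.
  apply: (le_trans (enorm_subl z z0)); rewrite lerD2l.
  exact: le_trans (ltW zz0) rho_1.
have z0B : enorm z0 <= enorm z0 + 1 by rewrite lerDl.
have zn : enorm (zz - newton_pt z0) < rho1.
  apply: (le_lt_trans (enorm_trans (newton_pt z) _ _)).
  have h2 := le_trans (hC _ _ zB z0B) (ler_wpM2l C0 (ltW zz0)).
  apply: (lt_le_trans (ltr_leD zzn h2)).
  apply: le_trans rho_2.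
  have -> : rho * (2 * (C + 1)) = (rho + C * rho) + (rho + C * rho) by ring.
  by rewrite lerDl addr_ge0 ?mulr_ge0 ?(ltW rho0).
have [d0 Dd0 dd0] := h1 _ _ zn Dd.
exists d0 => //.
have -> : dirf z d - dirf z0 d0 = col_mx
   (usubmx (d - d0) - sens z (dsubmx (d - d0)) - (sens z (dsubmx d0) - sens z0 (dsubmx d0)))
   (betahat *: (grady G z - grady G z0)).
  rewrite /dirf opp_col_mx add_col_mx scalerBr; congr col_mx.
  rewrite !linearB/= sensB; move: (sens z _) (sens z _) (sens z0 _) => a b c.
  by apply/matrixP => i j; rewrite !mxE; ring.
apply: (le_trans (enorm_col_mx _ _)); rewrite enormZ (ger0_norm bh0).
have d0M := D_bound Dd0.
have g1 : enorm (usubmx (d - d0) - sens z (dsubmx (d - d0))) <= (1 + lm) * enorm (d - d0).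
  apply: (le_trans (enormB _ _)); rewrite mulrDl mul1r lerD ?enorm_usubmx//.
  by apply: (le_trans (sb _ _)); rewrite ler_wpM2l// enorm_dsubmx.
have g5 : enorm (sens z (dsubmx d0) - sens z0 (dsubmx d0)) <= CM * rho * Mf.
  apply: (le_trans (sl _ _ _)); apply: ler_pM; rewrite ?enorm_ge0//.
  - by rewrite mulr_ge0// enorm_ge0.
  - by rewrite ler_wpM2l// ltW.
  - exact: le_trans (enorm_dsubmx _) d0M.
have g6 : betahat * enorm (grady G z - grady G z0) <= betahat * (Lg * rho).
  rewrite ler_wpM2l//; apply: (le_trans (grady_lip _ _)).
  by rewrite ler_wpM2l// ltW.
have g7 : (1 + lm) * enorm (d - d0) <= e / 2.
  have l1 : 0 < 1 + lm by rewrite ltr_pwDl.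
  rewrite mulrC -ler_pdivlMr//; apply: (le_trans (ltW dd0)).
  by rewrite invfM mulrA.
have g8 : CM * rho * Mf + betahat * (Lg * rho) <= e / 2.
  rewrite ler_pdivlMr//; apply: le_trans rho_3.
  have -> : (CM * rho * Mf + betahat * (Lg * rho)) * 2 = rho * (2 * K) by rewrite /K; ring.
  by rewrite ler_wpM2l ?(ltW rho0)// ler_wpM2l// lerDl.
apply: (le_trans (lerD (enormB _ _) g6)); rewrite [leRHS]splitr -addrA; apply: lerD.
  exact: le_trans g1 g7.
by apply: le_trans g8; rewrite lerD2r.
Qed.

(** The rate produced by [descent]. For d in the field at the Newton point of z, it vanishes only if
    d witnesses stationarity of z. *)
Definition descent_rate z d := enorm (usubmx d - sens z (dsubmx d)) ^+ 2 / 2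
  + 5 * (beta * Lg * enorm (grady G z)) ^+ 2.

(** By compactness: pairs with vanishing rates converging to zs would yield, through the closed
    graph, an element of the field that witnesses stationarity. *)
Lemma nonstat_lower zs : ~ stationary D G H (usubmx zs) (dsubmx zs) ->
  exists2 c, 0 < c & exists2 rho, 0 < rho & forall z d,
  enorm (z - zs) < rho -> D (newton_pt z) d -> c <= descent_rate z d.
Proof.
move=> ns; apply: contrapT => hn.
have h (k : nat) : exists zd : 'cV[R]_(n + p) * 'cV[R]_(n + p), enorm (zd.1 - zs) < k.+1%:R^-1 /\
    D (newton_pt zd.1) zd.2 /\ descent_rate zd.1 zd.2 < k.+1%:R^-1 ^+ 2.
  (* A square because the rate is quadratic: both residuals are then of order 1 / (k + 1). *)
  apply: contrapT => hk; apply: hn; exists (k.+1%:R^-1 ^+ 2); first by rewrite exprn_gt0// invr_gt0.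
  exists k.+1%:R^-1; first by rewrite invr_gt0.
  move=> z d zz Dzd; rewrite leNgt; apply/negP => hr; apply: hk.
  by exists (z, d).
have [zd zdP] := choice h.
have [U UU Uoo] := ultra_infty.
have [d dP] : exists d, ulim U (fun k => (zd k).2) d.
  by apply: (@ulim_exists _ _ UU _ _ Mf) => k; exact: D_bound (zdP k).2.1.
have [C C0 hC] := newton_pt_lip (enorm zs + 1).
have inv1 k : (k.+1%:R^-1 : R) <= 1 by rewrite invf_le1// ler1n.
have zlim e : 0 < e -> U [set k | enorm ((zd k).1 - zs) < e].
  move=> e0; apply: filterS (inv_nat_small UU Uoo e0) => k /=; exact: lt_trans (zdP k).1.
have nlim : ulim U (fun k => newton_pt (zd k).1) (newton_pt zs).
  move=> e e0; have e10 : 0 < e / (C + 1) by rewrite divr_gt0// ltr_wpDl.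
  apply: filterS (zlim _ e10) => k /=; rewrite ltr_pdivlMr ?ltr_wpDl//.
  move=> hk; apply: le_lt_trans hk.
  have h1 : enorm (zd k).1 <= enorm zs + 1.
    apply: (le_trans (enorm_subl _ zs)); rewrite lerD2l.
    exact: le_trans (ltW (zdP k).1) (inv1 k).
  have h2 : enorm zs <= enorm zs + 1 by rewrite lerDl.
  apply: (le_trans (hC _ _ h1 h2)).
  by rewrite mulrC ler_wpM2l ?enorm_ge0// lerDl.
have Dd : D (newton_pt zs) d.
  exact: (graph_ulim D_closed UU nlim dP (fun k => (zdP k).2.1)).
have bL : 0 < beta * Lg by rewrite mulr_gt0// beta_gt0.
clear hbeta hbetahat.
have small (k : nat) (a := (k.+1%:R^-1 : R)) :
    enorm (usubmx (zd k).2 - sens (zd k).1 (dsubmx (zd k).2)) <= 2 * a /\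
    beta * Lg * enorm (grady G (zd k).1) <= a.
  have a0 : 0 < a by rewrite invr_gt0.
  have := (zdP k).2.2; rewrite /descent_rate -/a.
  set nu := enorm _; set q := beta * Lg * _ => hk.
  have nu0 : 0 <= nu by exact: enorm_ge0.
  have q0 : 0 <= q by rewrite mulr_ge0 ?(ltW bL)// enorm_ge0.
  have := sqr_ge0 q; have := sqr_ge0 nu => nn qq.
  split.
  - by rewrite -ler_sqr ?nnegrE//; [lra|rewrite mulr_ge0// ltW].
  - by rewrite -ler_sqr ?nnegrE//; [lra|exact: ltW].
have r0 : grady G zs = 0.
  apply: enorm_eq0; apply/eqP; rewrite eq_le enorm_ge0 andbT -(pmulr_rle0 _ bL).
  apply/ler_addgt0Pr => e e0; rewrite add0r.
  have q0 : 0 < 2 * (beta * Lg * Lg + 1) by rewrite mulr_gt0// ltr_wpDl// mulr_ge0 ?ltW.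
  have e10 : 0 < e / (2 * (beta * Lg * Lg + 1)) by rewrite divr_gt0.
  have e20 : 0 < e / 2 by rewrite divr_gt0.
  have [k /= [hk1 hk2]] := filter_ex (filterI (zlim _ e10) (inv_nat_small UU Uoo e20)).
  have [_ hs] := small k.
  rewrite [e]splitr; apply: (le_trans (ler_wpM2l (ltW bL) (enorm_subl _ (grady G (zd k).1)))).
  rewrite mulrDr; apply: lerD; first exact: le_trans hs (ltW hk2).
  apply: (le_trans (ler_wpM2l (ltW bL) (grady_lip _ _))); rewrite enormBC.
  move: hk1; rewrite ltr_pdivlMr// => /ltW hk1.
  rewrite ler_pdivlMr//; apply: le_trans hk1; set N := enorm _.
  have -> : beta * Lg * (Lg * N) * 2 = N * (2 * (beta * Lg * Lg)) by ring.
  by rewrite ler_wpM2l ?enorm_ge0// ler_wpM2l// lerDl.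
have [lm lm0 sb] : exists2 lm, 0 <= lm & forall z b, enorm (sens z b) <= lm * enorm b.
  by exists (Lg / mu); [rewrite divr_ge0 ?ltW|exact: sens_bound].
have [CM CM0 sl] := sens_lip_ex.
have u0 : usubmx d - sens zs (dsubmx d) = 0.
  apply: enorm_eq0; apply/eqP; rewrite eq_le enorm_ge0 andbT.
  apply/ler_addgt0Pr => e e0; rewrite add0r.
  pose K := 2 + CM * Mf + (lm + 1).
  have CMf0 : 0 <= CM * Mf by rewrite mulr_ge0// ltW.
  have K0 : 0 < K by exact: ltr_wpDr (addr_ge0 lm0 ler01) (ltr_wpDr CMf0 (ltr0Sn _ 1)).
  have e10 : 0 < e / K by rewrite divr_gt0.
  have [k /= [[hk1 hk2] hk3]] := filter_ex (filterI (filterI (zlim _ e10) (inv_nat_small UU Uoo e10)) (dP _ e10)).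
  have [hs _] := small k.
  set zk := (zd k).1 in hk1 hs; set dk := (zd k).2 in hs hk3.
  have dkM : enorm dk <= Mf := D_bound (zdP k).2.1.
  have -> : usubmx d - sens zs (dsubmx d) = (usubmx dk - sens zk (dsubmx dk))
      + (sens zk (dsubmx dk) - sens zs (dsubmx dk))
      + (sens zs (dsubmx (dk - d)) - usubmx (dk - d)).
    rewrite !linearB/= sensB; move: (sens zk _) (sens zs _) (sens zs _) => a b c.
    by apply/matrixP => i j; rewrite !mxE; ring.
  have eK : e = 2 * (e / K) + CM * Mf * (e / K) + (lm + 1) * (e / K).
    by rewrite -!mulrDl -/K mulrC divfK// gt_eqF.
  rewrite eK; apply: (le_trans (enormD _ _)); apply: lerD.
    apply: (le_trans (enormD _ _)); apply: lerD.
      by apply: (le_trans hs); rewrite ler_wpM2l// ltW.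
    apply: (le_trans (sl _ _ _)); rewrite mulrAC; apply: ler_pM; rewrite ?enorm_ge0//.
    - by rewrite mulr_ge0 ?enorm_ge0.
    - by rewrite ler_wpM2l//; exact: le_trans (enorm_dsubmx _) dkM.
    - exact: ltW.
  apply: (le_trans (enormB _ _)); rewrite mulrDl mul1r; apply: lerD.
    apply: (le_trans (sb _ _)); rewrite ler_wpM2l//.
    exact: le_trans (enorm_dsubmx _) (ltW hk3).
  exact: le_trans (enorm_usubmx _) (ltW hk3).
apply: ns.
(* With a zero y-gradient the Newton step is null, so d belongs to the field at zs itself. *)
have nz : newton_pt zs = zs by rewrite /newton_pt /newton r0 mulmx0 subr0 vsubmxK.
split; last by rewrite vsubmxK.
exists (usubmx d), (dsubmx d); rewrite !vsubmxK; split; first by rewrite -{1}nz.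
exact: u0.
Qed.

(** One well-chosen d bounds the maximum from below. The velocity V of the Newton image is compared
    with d through finite increments, so no chain rule for the Newton map is invoked. *)
Lemma integrand_lower (c : R -> 'cV[R]_(n + p)) (tau c0 t phi : R) (pc V : 'cV[R]_(n + p)) :
  0 < tau -> has_vel c t pc -> has_vel (fun s => newton_pt (c s)) t V ->
  is_derive t 1 (fun s => penalty (c s)) phi ->
  (forall e, 0 < e -> exists2 d, D (newton_pt (c t)) d & enorm (pc - tau *: dirf (c t) d) <= e) ->
  (forall d, D (newton_pt (c t)) d -> c0 <= descent_rate (c t) d) ->
  tau * c0 - phi <= field_integrand D (fun s => newton_pt (c s)) t.
Proof.
move=> tau0 cv gv pd incl low; have tau0' := ltW tau0.
apply/ler_addgt0Pr => e e0.
set z0 := c t in incl low *.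
set C := 2 * ((1 + Lg / mu) * Mf)
  + (beta * mu / 4 + 2 * (beta * Lg) + betahat) * enorm (grady G z0) + 1.
have C0 : 0 <= C.
  have l0 : 0 <= Lg / mu by rewrite divr_ge0 ?ltW.
  have h1 : 0 <= (1 + Lg / mu) * Mf by rewrite mulr_ge0 ?(ltW hMf)//; lra.
  have h2 : 0 <= (beta * mu / 4 + 2 * (beta * Lg) + betahat) * enorm (grady G z0).
    rewrite mulr_ge0 ?enorm_ge0//.
    have := mulr_gt0 beta_gt0 hmu; have := mulr_gt0 beta_gt0 hLg; have := betahat_ge0; lra.
  by rewrite /C; lra.
(* tau C is the error of [descent] per unit of h; the rest covers the linearization of the Newton
   image and of the penalty. *)
pose K := tau * C + tau * (Mf + 1).
have K0 : 0 < K.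
  have := mulr_ge0 tau0' C0; have := mulr_gt0 tau0 hMf; rewrite /K; lra.
pose e1 := Num.min 1 (e / K).
have e10 : 0 < e1 by rewrite lt_min ltr01 divr_gt0.
have e11 : e1 <= 1 by rewrite ge_min lexx.
have e1K : e1 * K <= e.
  by rewrite -ler_pdivlMr// ge_min lexx orbT.
pose e2 := e1 * tau / 2.
have e20 : 0 < e2 by rewrite divr_gt0// mulr_gt0.
have [d Dd hd] := incl _ e20.
have dM := D_bound Dd.
have supV : dot V d <= field_integrand D (fun s => newton_pt (c s)) t.
  rewrite /field_integrand (has_vel_derive1 gv); apply: sup_ubound; last by exists d.
  exists (enorm V * Mf) => _ [v /= /D_bound vM <-].
  by apply: (le_trans (dot_le _ _)); rewrite ler_wpM2l// enorm_ge0.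
suff : tau * c0 - phi <= dot V d + e by lra.
have [rho rho0 hrho] := expansion z0 (ltW beta_gt0) e10.
have [d1 d10 h1] := cv _ e20.
have [d2 d20 h2] := gv _ e20.
have [d3 d30 h3] := eps_is_derive pd e20.
pose h := Num.min (Num.min d1 d2) (Num.min d3 (rho / (enorm pc + e2))) / 2.
have pc0 := enorm_ge0 pc.
have hm : 0 < Num.min (Num.min d1 d2) (Num.min d3 (rho / (enorm pc + e2))).
  by rewrite !lt_min d10 d20 d30 divr_gt0//; lra.
have h0 : 0 < h by rewrite divr_gt0.
have hle x : Num.min (Num.min d1 d2) (Num.min d3 (rho / (enorm pc + e2))) <= x -> h < x.
  by apply: lt_le_trans; rewrite /h; lra.
have hd1 : h < d1 by apply: hle; rewrite !ge_min lexx.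
have hd2 : h < d2 by apply: hle; rewrite !ge_min lexx orbT.
have hd3 : h < d3 by apply: hle; rewrite !ge_min lexx !orbT.
have hr : h * (enorm pc + e2) < rho.
  have : h < rho / (enorm pc + e2) by apply: hle; rewrite !ge_min lexx !orbT.
  by rewrite ltr_pdivlMr//; lra.
have nh : `|- h| = h by rewrite normrN gtr0_norm.
have {}h1 := h1 (- h); rewrite nh in h1; have {}h1 := h1 hd1.
have {}h2 := h2 (- h); rewrite nh in h2; have {}h2 := h2 hd2.
have {}h3 := h3 (- h); rewrite nh in h3; have {}h3 := h3 hd3.
(* The increment is taken backwards: c moves along tau times [dirf], and [descent] concerns steps
   against it. *)
pose dlt := c (t - h) - c t.
have cE : c (t - h) = z0 + dlt by rewrite /dlt -/z0 subrKC.
rewrite -/z0 -/dlt scaleNr opprK in h1.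
have dltn : enorm dlt < rho.
  have := enorm_subl dlt (- (h *: pc)); rewrite opprK enormN enormZ (gtr0_norm h0); lra.
have ht0 : 0 < h * tau by rewrite mulr_gt0.
have hdir : enorm (dlt + (h * tau) *: dirf z0 d) <= e1 * (h * tau).
  have -> : dlt + (h * tau) *: dirf z0 d = (dlt + h *: pc) - h *: (pc - tau *: dirf z0 d).
    by apply/matrixP => i j; rewrite !mxE; ring.
  apply: (le_trans (enormB _ _)); rewrite enormZ (gtr0_norm h0).
  have := ler_wpM2l (ltW h0) hd; rewrite /e2 in h1 *; lra.
have e1b : 0 <= e1 <= 1 by rewrite (ltW e10).
have := le_trans (hrho _ _ dltn dM) (descent hbeta hbetahat ht0 e1b hdir dM).
rewrite -/C -/(descent_rate z0 d) -cE => key.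
have lowd := ler_wpM2l (ltW ht0) (low _ Dd).
have gE : - (h * dot V d) - e2 * h * Mf <= dot (newton_pt (c (t - h)) - newton_pt z0) d.
  set w := newton_pt (c (t - h)) - newton_pt z0.
  rewrite -/z0 -/w scaleNr opprK in h2.
  have -> : w = (w + h *: V) - h *: V by rewrite addrK.
  rewrite dotDl dotNl dotZl addrC lerD2r.
  rewrite lerNl -dotNl; apply: (le_trans (dot_le _ _)); rewrite enormN.
  by apply: ler_pM; rewrite ?enorm_ge0.
have pE : - (h * phi) - e2 * h <= penalty (c (t - h)) - penalty z0.
  by move: h3; rewrite -/z0 ler_norml => /andP[+ _]; lra.
rewrite -(ler_pM2l h0).
have : h * (e1 * K) <= h * e by rewrite ler_wpM2l// ltW.
have e2h : 0 <= e2 * h * Mf by exact: mulr_ge0 (mulr_ge0 (ltW e20) (ltW h0)) (ltW hMf).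
have e2h' : 0 <= e2 * h by exact: mulr_ge0 (ltW e20) (ltW h0).
move: gE pE e2h e2h'; rewrite /K /e2; lra.
Qed.

(** The curve runs against the flow, so the value grows from [c 0] to [c 1]. The field integral is
    the increment of f along the Newton image and the integral of [phi] that of the penalty. *)
Lemma curve_decrease (c : R -> 'cV[R]_(n + p)) (tau c0 M B : R) : 0 < tau ->
  (forall a b, enorm (c a - c b) <= M * `|a - b|) -> (forall a, enorm (c a) <= B) ->
  (forall t pc, t \in `]0, 1[ -> has_vel c t pc ->
     forall e, 0 < e -> exists2 d, D (newton_pt (c t)) d &
       enorm (pc - tau *: dirf (c t) d) <= e) ->
  (forall t d, t \in `]0, 1[ -> D (newton_pt (c t)) d -> c0 <= descent_rate (c t) d) ->
  tau * c0 <= (f (newton_pt (c 1)) + penalty (c 1)) - (f (newton_pt (c 0)) + penalty (c 0)).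
Proof.
move=> tau0 cM cB incl low.
have [C1 C10 hC1] := newton_pt_lip B; have [C2 C20 hC2] := penalty_lip B.
have nlip a b : enorm (newton_pt (c a) - newton_pt (c b)) <= C1 * M * `|a - b|.
  by apply: (le_trans (hC1 _ _ (cB a) (cB b))); rewrite -mulrA ler_wpM2l.
have plip a b : `|penalty (c a) - penalty (c b)| <= C2 * M * `|a - b|.
  by apply: (le_trans (hC2 _ _ (cB a) (cB b))); rewrite -mulrA ler_wpM2l.
have colip (h : R -> 'cV[R]_(n + p)) L i : (forall a b, enorm (h a - h b) <= L * `|a - b|) ->
    forall a b, `|h a i 0 - h b i 0| <= L * `|a - b|.
  move=> hl a b; apply: le_trans (hl a b); apply: le_trans (coord_le_enorm _ i).
  by rewrite !mxE.
have [phi [iphi aephi intphi]] := lipschitz_FTC plip.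
have [pc pcP] := choice (fun i => lipschitz_FTC (colip c M i cM)).
have [V VP] := choice (fun i => lipschitz_FTC (colip _ _ i nlip)).
have ac : abs_cont_curve (fun s => newton_pt (c s)) by exact: (lipschitz_abs_cont nlip).
have := f_pot ac; rewrite /field_integral => fE.
pose psi t := tau * c0 - phi t.
have icst : (@lebesgue_measure R).-integrable `[0, 1]%classic (EFin \o cst (tau * c0)).
  apply: continuous_compact_integrable; first exact: segment_compact.
  by apply: continuous_subspaceT => t; exact: cvg_cst.
have ipsi : (@lebesgue_measure R).-integrable `[0, 1]%classic (EFin \o psi).
  have -> : EFin \o psi = ((EFin \o cst (tau * c0)%R) \- (EFin \o phi))%E by [].
  exact: integrableB.
have ae1 : {ae (@lebesgue_measure R), forall t : R, forall i, t \in `]0, 1[ ->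
    is_derive t 1 (fun s => c s i 0) (pc i t)}.
  by apply: filter_forall => i; have [] := pcP i.
have ae2 : {ae (@lebesgue_measure R), forall t : R, forall i, t \in `]0, 1[ ->
    is_derive t 1 (fun s => newton_pt (c s) i 0) (V i t)}.
  by apply: filter_forall => i; have [] := VP i.
have := integral_ae_ge (f := field_integrand D (fun s => newton_pt (c s))) ipsi.
rewrite fE => h.
have {}h : (\int[@lebesgue_measure R]_(t in `[0%R, 1%R]%classic) (psi t)%:E <=
    (f (newton_pt (c 1)) - f (newton_pt (c 0)))%:E)%E.
  have FF := ae_filter_ringOfSetsType (@lebesgue_measure R).
  apply: h; apply: (@filterS3 _ _ FF) ae1 ae2 aephi => t h1 h2 h3 tI.
  have cv : has_vel c t (\col_i pc i t) by apply: has_vel_coord => i; exact: h1.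
  have gv : has_vel (fun s => newton_pt (c s)) t (\col_i V i t).
    by apply: has_vel_coord => i; exact: h2.
  apply: (integrand_lower tau0 cv gv (h3 tI)).
  - exact: incl cv.
  - by move=> d; exact: low.
move: h.
have -> : (\int[@lebesgue_measure R]_(t in `[0%R, 1%R]%classic) (psi t)%:E =
    (tau * c0 - (penalty (c 1) - penalty (c 0)))%:E)%E.
  under eq_integral do rewrite EFinB.
  rewrite integralB// intphi integral_cst//= lebesgue_measure_itv/= lte_fin ltr01.
  by rewrite -?EFinB -?EFinM -?EFinB; congr EFin; ring.
by rewrite lee_fin; lra.
Qed.

(** * The iterates of the algorithm *)

Variables (x : nat -> 'cV[R]_n) (y w v : nat -> 'cV[R]_p).
Variables (dx : nat -> 'cV[R]_n) (dy : nat -> 'cV[R]_p) (eta eps1 eps2 : nat -> R) (B : R).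
Let z k := col_mx (x k) (y k).
Hypothesis hw : forall k, enorm (hessyy H (z k) *m w k - grady G (z k)) <= eps1 k.
Hypothesis hd : forall k, D (col_mx (x k) (y k - w k)) (col_mx (dx k) (dy k)).
Hypothesis hv : forall k, enorm (hessyy H (z k) *m v k - dy k) <= eps2 k.
Hypothesis hx : forall k, x k.+1 = x k - eta k *: (dx k - hessxy H (z k) *m v k).
Hypothesis hy : forall k, y k.+1 = y k - (eta k * betahat) *: grady G (z k).
Hypothesis zB : forall k, enorm (z k) <= B.
Hypothesis eta0 : forall k, 0 <= eta k.
Hypothesis eta_div : series eta @ \oo --> +oo.
Hypothesis eta_sq : cvg (series (fun k => eta k ^+ 2) @ \oo).
Hypothesis heps1 : eps1 @ \oo --> 0.
Hypothesis heps2 : cvg (series (fun k => eps2 k * eta k) @ \oo).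

(** [dir] uses the exact inverse in place of v_k, whose error is moved to [xi] with bounds [th] of
    convergent series. The error in w_k remains in the point where the field is evaluated. *)
Let dir k := dirf (z k) (col_mx (dx k) (dy k)).
Let xi k : 'cV[R]_(n + p) := col_mx (eta k *: (hessxy H (z k) *m v k - sens (z k) (dy k))) 0.
Let th k := Lg / mu * (eps2 k * eta k).
Let M := (1 + Lg / mu) * Mf + betahat * (enorm (grady G 0) + Lg * B).
Let lyap z := f (newton_pt z) + penalty z.

Let z_step k : z k.+1 = z k - eta k *: dir k + xi k.
Proof.
rewrite /z hx hy /dir /dirf /xi col_mxKu col_mxKd scale_col_mx opp_col_mx !add_col_mx addr0 scalerA.
rewrite -/(z k); congr col_mx; move: (sens _ _) (hessxy _ _ *m _) => a b.
by apply/matrixP => i j; rewrite !mxE; ring.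
Qed.

Let dir_bound k : enorm (dir k) <= M.
Proof.
apply: (le_trans (dirf_bound _ (D_bound (hd k)))); rewrite lerD2l ler_wpM2l ?betahat_ge0//.
by apply: (le_trans (grady_bound _)); rewrite lerD2l ler_wpM2l ?(ltW hLg).
Qed.

Let xi_bound k : enorm (xi k) <= th k.
Proof.
rewrite /xi enorm_col_mx0 enormZ ger0_norm// /th mulrA mulrC ler_wpM2r//.
have -> : hessxy H (z k) *m v k - sens (z k) (dy k) =
    hessxy H (z k) *m (invmx (hessyy H (z k)) *m (hessyy H (z k) *m v k - dy k)).
  by rewrite mulmxBr mulKmx ?hessyy_unit// mulmxBr.
apply: (le_trans (sens_bound _ _)); rewrite ler_wpM2l// ?divr_ge0 ?(ltW hLg) ?(ltW hmu)//.
Qed.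

Let eta_cvg0 e : 0 < e -> exists N, forall k, (N <= k)%N -> eta k < e.
Proof.
move=> e0; have e20 : 0 < e ^+ 2 by rewrite exprn_gt0.
have /cvgrPdist_lt/(_ _ e20)[N _ NP] := cvg_series_cvg_0 eta_sq.
exists N => k Nk; have := NP k Nk; rewrite /= sub0r normrN ger0_norm ?sqr_ge0//.
by rewrite ltr_sqr ?nnegrE ?(ltW e0).
Qed.

Let th_cauchy e : 0 < e -> exists N, forall k l, (N <= k)%N -> (k <= l)%N ->
  series th l - series th k < e.
Proof.
move=> e0; have lm0 : 0 < Lg / mu by rewrite divr_gt0.
have /cvg_ex[a ha] := heps2.
have e10 : 0 < e / (Lg / mu) / 2 by rewrite !divr_gt0.
have /cvgrPdist_lt/(_ _ e10)[N _ NP] := ha.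
exists N => k l Nk kl.
have thE m : series th m = Lg / mu * series (fun k => eps2 k * eta k) m.
  by rewrite /series/= mulr_sumr.
rewrite !thE -mulrBr mulrC -ltr_pdivlMr//.
set q := e / (Lg / mu) in NP *.
have := NP k Nk; have := NP l (leq_trans Nk kl); rewrite /= !ltr_norml => /andP[h1 _] /andP[_ h2].
lra.
Qed.

Let S_unbounded T : exists m, T < series eta m.
Proof.
have /cvgryPgt/(_ T)[N _ NP] := eta_div.
by exists N; apply: NP => /=.
Qed.

Let idx_exists : exists idx : R -> nat,
  forall T, 0 <= T -> series eta (idx T) <= T < series eta (idx T).+1.
Proof.
(* The least index whose partial sum exceeds T is positive, because the empty sum is 0; its
   predecessor is the step in progress. *)
exists (fun T => (ex_minn (S_unbounded T)).-1) => T T0; case: ex_minnP => -[|m] /= hm hmin.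
  by move: hm; rewrite /series/= big_geq// ltNge T0.
rewrite hm andbT leNgt; apply/negP => /hmin; by rewrite ltnn.
Qed.

(** The decrease is stated for every small tau because the oscillation argument has to shorten tau
    afterwards. *)
Lemma local_decrease (U : set_system nat) (idx : R -> nat) zs : UltraFilter U ->
  (forall N, U [set k | (N <= k)%N]) ->
  (forall T, 0 <= T -> series eta (idx T) <= T < series eta (idx T).+1) ->
  ulim U z zs -> ~ stationary D G H (usubmx zs) (dsubmx zs) ->
  exists2 c, 0 < c & exists2 tau0, 0 < tau0 & forall tau, 0 < tau <= tau0 ->
    U [set k | lyap (z (idx (series eta k + tau))) <= lyap zs - tau * c].
Proof.
move=> UU Uoo idxP zzs ns.
have [c0 c00 [rho rho0 low]] := nonstat_lower ns.
have M0 : 0 <= M by exact: le_trans (enorm_ge0 _) (dir_bound 0%N).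
have M1 : 0 < M + 1 by lra.
have [zeta zetaP] := limit_curve_exists eta zB idx UU.
have zlip := limit_curve_lip z_step dir_bound eta0 eta_cvg0 xi_bound th_cauchy idxP UU Uoo zetaP.
have zbd := limit_curve_bound zB UU zetaP.
have z0 := limit_curve_start z_step dir_bound eta0 xi_bound th_cauchy idxP UU Uoo zetaP zzs.
have incl := limit_curve_velocity z_step dir_bound eta0 eta_cvg0 xi_bound th_cauchy idxP UU Uoo zetaP.
exists (c0 / 2); first by rewrite divr_gt0.
(* At speed at most M the limit curve stays within rho of zs up to this time. *)
exists (rho / (M + 1)); first by rewrite divr_gt0.
move=> tau /andP[tau0 tau_le]; rewrite ler_pdivlMr// in tau_le.
(* Reversed and rescaled to [0, 1]: [c 1] is the limit point and [c 0] the position after time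
   tau. *)
pose c t := zeta (tau * (1 - t)).
have dec : tau * c0 <= lyap (c 1) - lyap (c 0).
  apply: (@curve_decrease c tau c0 (M * tau) B) => //.
  - move=> a b; apply: (le_trans (zlip _ _)); rewrite -mulrA ler_wpM2l//.
    have -> : tau * (1 - a) - tau * (1 - b) = tau * (b - a) by ring.
    by rewrite normrM (gtr0_norm tau0) distrC.
  - by move=> a; exact: zbd.
  - move=> t pc; rewrite in_itv/= => /andP[t0 t1] cv e e0.
    set s0 := tau * (1 - t).
    have s00 : 0 <= s0 by rewrite mulr_ge0 ?(ltW tau0)//; lra.
    have zv : has_vel zeta s0 (- tau^-1 *: pc).
      move=> a a0; have a10 : 0 < a * tau by rewrite mulr_gt0.
      have [d d0 dP] := cv _ a10; exists (d * tau); first by rewrite mulr_gt0.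
      move=> s sd; have := dP (- (s / tau)).
      rewrite normrN normrM normfV (gtr0_norm tau0) ltr_pdivrMr// => /(_ sd).
      rewrite /c.
      have -> : tau * (1 - (t - s / tau)) = s0 + s by rewrite /s0; field; rewrite gt_eqF.
      rewrite -/s0 !scaleNr opprK scalerN opprK scalerA.
      by have -> : a * tau * (`|s| / tau) = a * `|s| by field; rewrite gt_eqF.
    have e10 : 0 < e / (2 * tau) by rewrite divr_gt0// mulr_gt0.
    have [rh rh0 near0] := dirf_near (zeta s0) e10.
    have /cvgrPdist_lt/(_ (rh * mu) (mulr_gt0 rh0 hmu))[K _ KP] := heps1.
    have CP i : (K <= i)%N -> enorm (z i - zeta s0) < rh ->
        [set P | exists2 d0, D (newton_pt (zeta s0)) d0 &
          enorm (P - dirf (zeta s0) d0) <= e / (2 * tau)] (dir i).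
      move=> Ki zi; apply: near0 (hd i) => //.
      have -> : col_mx (x i) (y i - w i) - newton_pt (z i) = col_mx 0
          (- (invmx (hessyy H (z i)) *m (hessyy H (z i) *m w i - grady G (z i)))).
        rewrite /newton_pt /newton /z col_mxKu col_mxKd opp_col_mx add_col_mx subrr -/(z i).
        rewrite mulmxBr mulKmx ?hessyy_unit//; congr col_mx.
        by move: (invmx _ *m _) => a; apply/matrixP => k l; rewrite !mxE; ring.
      rewrite enorm_col_0mx enormN; apply: (le_lt_trans (invhess_bound _ _)).
      rewrite ltr_pdivrMr//; apply: (le_lt_trans (hw i)).
      by have := KP i Ki; rewrite /= sub0r normrN => /(le_lt_trans (ler_norm _)).
    have [P [d Dd hPd] hPv] := incl _ _ _ _ _ (@dirf_set_convex _ _) s00 zv rh0 CP _ e10.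
    exists d; first exact: Dd.
    have -> : pc - tau *: dirf (c t) d =
        tau *: ((P - dirf (zeta s0) d) - (- tau^-1 *: pc + P)).
      rewrite /c -/s0; move: (dirf _ _) => a; apply/matrixP => i j; rewrite !mxE.
      by field; rewrite gt_eqF.
    rewrite enormZ (gtr0_norm tau0) mulrC -ler_pdivlMr//.
    apply: (le_trans (enormB _ _)).
    have -> : e / tau = e / (2 * tau) + e / (2 * tau) by field; rewrite gt_eqF.
    exact: lerD.
  - move=> t d; rewrite in_itv/= => /andP[t0 t1]; apply: low.
    rewrite /c -z0; apply: (le_lt_trans (zlip _ _)); rewrite subr0 ger0_norm; last first.
      by rewrite mulr_ge0 ?(ltW tau0)//; lra.
    have : tau * (1 - t) <= tau by rewrite ler_piMr ?(ltW tau0)//; lra.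
    by move=> /(ler_wpM2l M0); lra.
have [C C0 hC] := lyap_lip B.
(* The half of the decrease that is given up pays for passing from the limit curve to the
   iterates. *)
have e0 : 0 < tau * c0 / 2 / (C + 1) by rewrite !divr_gt0 ?mulr_gt0//; lra.
have ztau := zetaP tau _ e0.
apply: filterS ztau => k /=; rewrite (gtr0_norm tau0) ltr_pdivlMr; last lra.
move=> hk; move: dec; rewrite /c subrr mulr0 subr0 mulr1 z0.
have := hC _ _ (zB (idx (series eta k + tau))) (zbd tau); rewrite -/(lyap _) -/(lyap (zeta tau)).
rewrite ler_norml => /andP[_ h1].
have := enorm_ge0 (z (idx (series eta k + tau)) - zeta tau); lra.
Qed.

(** * Convergence of the values and stationarity of the limit points *)

Lemma lyap_stationary xs ys : stationary D G H xs ys -> lyap (col_mx xs ys) = f (col_mx xs ys).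
Proof.
move=> [_ r0]; rewrite /lyap /penalty r0 enorm0 expr0n mulr0 addr0.
by rewrite /newton_pt /newton r0 mulmx0 subr0 vsubmxK.
Qed.

Let lyap_ulim (U : set_system nat) zs : UltraFilter U -> ulim U z zs ->
  forall e, 0 < e -> U [set k | `|lyap (z k) - lyap zs| < e].
Proof.
move=> UU zzs e e0.
have zsB : enorm zs <= B.
  apply/ler_addgt0Pr => a a0; have [k /= hk] := filter_ex (zzs _ a0).
  by have := enorm_subl zs (z k); have := zB k; rewrite enormBC; lra.
have [C C0 hC] := lyap_lip B.
have e10 : 0 < e / (C + 1) by rewrite divr_gt0//; lra.
apply: filterS (zzs _ e10) => k /=; rewrite ltr_pdivlMr; last lra.
move=> hk; apply: (le_lt_trans (hC _ _ (zB k) zsB)).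
by have := enorm_ge0 (z k - zs); lra.
Qed.

Lemma lyap_cvg :
  interior [set r : R | exists xs ys, stationary D G H xs ys /\ r = f (col_mx xs ys)] = set0 ->
  cvg ((fun k => lyap (z k)) @ \oo).
Proof.
move=> hc.
have M0 : 0 <= M by exact: le_trans (enorm_ge0 _) (dir_bound 0%N).
have [idx idxP] := idx_exists.
have [U0 UU0 U0oo] := ultra_infty.
have [z1 z1P] : exists l, ulim U0 z l by exact: (ulim_exists UU0 zB).
pose l := lyap z1.
apply: contrapT => ncv.
have [e e0 he] : exists2 e, 0 < e & forall N, exists2 k, (N <= k)%N & e <= `|lyap (z k) - l|.
  apply: contrapT => hn; apply: ncv; apply/cvg_ex; exists l; apply/cvgrPdist_lt => e e0.
  apply: contrapT => hN; apply: hn; exists e => // N; apply: contrapT => hk; apply: hN.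
  exists N => // k /= Nk; rewrite distrC ltNge; apply/negP => h; apply: hk.
  by exists k.
have hl N : exists2 k, (N <= k)%N & `|lyap (z k) - l| < e / 2.
  have e20 : 0 < e / 2 by rewrite divr_gt0.
  have [k /= [h1 h2]] := filter_ex (filterI (lyap_ulim UU0 z1P e20) (U0oo N)).
  by exists k.
(* Deviations of at least e recur above or below l, and so do values within e / 2 of l: two
   separated levels are visited infinitely often. *)
have [a [b [ab ha hb]]] : exists a b, [/\ a < b,
    (forall N, exists2 k, (N <= k)%N & lyap (z k) <= a) &
    (forall N, exists2 k, (N <= k)%N & b <= lyap (z k))].
  have [hup|hup] := pselect (forall N, exists2 k, (N <= k)%N & l + e <= lyap (z k)).
    exists (l + e / 2), (l + e); split => //; first lra.
    move=> N; have [k Nk hk] := hl N; exists k => //.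
    by move: hk; rewrite ltr_norml => /andP[_]; lra.
  exists (l - e), (l - e / 2); split; first lra.
    move: hup => /existsNP[N1 hN1] N.
    have [k Nk hk] := he (maxn N N1); exists k; first exact: leq_trans (leq_maxl _ _) Nk.
    have N1k : (N1 <= k)%N by exact: leq_trans (leq_maxr _ _) Nk.
    have : ~ (l + e <= lyap (z k)) by move=> h; apply: hN1; exists k.
    move=> /negP; rewrite -ltNge => h.
    by move: hk; rewrite ler_normr => /orP[]; lra.
  move=> N; have [k Nk hk] := hl N; exists k => //.
  by move: hk; rewrite ltr_norml => /andP[]; lra.
have [c [ac cb cns]] : exists c, [/\ a < c, c < b &
    ~ exists xs ys, stationary D G H xs ys /\ c = f (col_mx xs ys)].
  apply: contrapT => hn.
  have : set0 ((a + b) / 2); last by [].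
  rewrite -hc /interior /=.
  have : nbhs ((a + b) / 2) (`]a, b[%classic : set R).
    by apply: near_in_itvoo; rewrite in_itv/=; apply/andP; split; lra.
  apply: filterS => r /=; rewrite in_itv/= => /andP[ar rb].
  by apply: contrapT => hr; apply: hn; exists r.
(* The last index at or below level c before an excursion up to b. *)
pose K := [set k | lyap (z k) <= c /\ exists m, [/\ (k < m)%N, b <= lyap (z m) &
  forall i, (k < i <= m)%N -> c < lyap (z i)]].
have KP N : exists2 k, (N <= k)%N & K k.
  have [k0 Nk0 hk0] := ha N; have [m k0m hm] := hb k0.
  have ex : exists i, (k0 <= i <= m)%N && (lyap (z i) <= c).
    by exists k0; rewrite leqnn k0m /=; lra.
  have bnd i : (k0 <= i <= m)%N && (lyap (z i) <= c) -> (i <= m)%N by move=> /andP[/andP[]].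
  have [k /andP[/andP[k0k km] hkc] kmax] := ex_maxnP ex bnd.
  exists k; first exact: leq_trans k0k.
  have klm : (k < m)%N.
    rewrite ltn_neqAle km andbT; apply/eqP => kmE; move: hm; rewrite -kmE; lra.
  split => //; exists m; split => // i /andP[ki im].
  rewrite ltNge; apply/negP => hi.
  have := kmax i; rewrite im hi (leq_trans k0k (ltnW ki))/= => /(_ isT).
  by rewrite leqNgt ki.
have [U UU UK] : exists2 U : set_system nat, UltraFilter U & forall N, U [set k | (N <= k)%N /\ K k].
  apply: (@ultra_from (fun N => [set k | (N <= k)%N /\ K k])).
    by move=> N; have [k Nk Kk] := KP N; exists k.
  by move=> i j ij k /= [jk Kk]; split => //; exact: leq_trans jk.
have Uoo N : U [set k | (N <= k)%N] by apply: filterS (UK N) => k [].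
have UKK : U K by apply: filterS (UK 0%N) => k [].
have [zs zsP] : exists l, ulim U z l by exact: (ulim_exists UU zB).
have [C C0 hC] := lyap_lip B.
have C1 : 0 < C + 1 by lra.
have step e1 : 0 < e1 -> exists2 t1, 0 < t1 & exists N, forall k i, (N <= k)%N -> (k <= i)%N ->
    series eta i - series eta k <= t1 -> `|lyap (z i) - lyap (z k)| < e1.
  move=> e10; have q0 : 0 < e1 / (2 * (C + 1)) by rewrite divr_gt0// mulr_gt0.
  exists (e1 / (2 * (C + 1) * (M + 1))); first by rewrite divr_gt0// !mulr_gt0//; lra.
  have [N NP] := th_cauchy q0; exists N => k i Nk ki hS.
  apply: (le_lt_trans (hC _ _ (zB i) (zB k))).
  have h1 := iterate_incr z_step dir_bound eta0 xi_bound ki.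
  have h2 := NP _ _ Nk ki.
  have h3 : M * (series eta i - series eta k) <= e1 / (2 * (C + 1)).
    apply: (le_trans (ler_wpM2l M0 hS)); rewrite invfM !mulrA ler_pdivrMr; last lra.
    by rewrite -mulrA; lra.
  have h4 : enorm (z i - z k) * (C + 1) < e1.
    rewrite -ltr_pdivlMr//; apply: (le_lt_trans h1).
    have -> : e1 / (C + 1) = e1 / (2 * (C + 1)) + e1 / (2 * (C + 1)) by field; rewrite gt_eqF.
    lra.
  by have := enorm_ge0 (z i - z k); lra.
(* At most c by the choice of K; at least c because the next value exceeds c and a single step
   changes the value arbitrarily little. *)
have lc : lyap zs = c.
  apply: le_anti; apply/andP; split; apply/ler_addgt0Pr => e1 e10.
    have [k /= [h1 [h2 _]]] := filter_ex (filterI (lyap_ulim UU zsP e10) UKK).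
    by move: h1; rewrite ltr_norml => /andP[h1 _]; lra.
  have e20 : 0 < e1 / 2 by rewrite divr_gt0.
  have [t1 t10 [N NP]] := step _ e20.
  have [N' NP'] := eta_cvg0 t10.
  have [k /= [[h1 [h2 [m [km hm hi]]]] [Nk N'k]]] :=
    filter_ex (filterI (filterI (lyap_ulim UU zsP e20) UKK) (filterI (Uoo N) (Uoo N'))).
  have hk1 := hi k.+1; rewrite leqnn km in hk1; have {}hk1 := hk1 isT.
  have := NP k k.+1 Nk (leqnSn k).
  rewrite seriesSr addrAC subrr add0r => /(_ (ltW (NP' k N'k))).
  by move: h1; rewrite !ltr_norml => /andP[h1 h1'] /andP[h3 h3']; lra.
have ns : ~ stationary D G H (usubmx zs) (dsubmx zs).
  move=> st; apply: cns; exists (usubmx zs), (dsubmx zs); split => //.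
  by rewrite -(lyap_stationary st) vsubmxK.
have [c0 c00 [t0 t00 dec]] := local_decrease UU Uoo idxP zsP ns.
have bc0 : 0 < b - c by lra.
have [t1 t10 [N NP]] := step _ bc0.
(* Below t0 the decrease applies; below t1 the values cannot climb from c to b. *)
pose tau := Num.min t0 t1.
have tau0 : 0 < tau by rewrite lt_min t00.
have tle0 : tau <= t0 by rewrite ge_min lexx.
have tle1 : tau <= t1 by rewrite ge_min lexx orbT.
have tc0 : 0 < tau * c0 by rewrite mulr_gt0.
have hdec := dec tau; rewrite tau0 tle0 in hdec; have {}hdec := hdec isT.
have [k /= [[h1 [h2 [m [km hm hi]]]] [Nk h3]]] :=
  filter_ex (filterI (filterI (lyap_ulim UU zsP tc0) UKK) (filterI (Uoo N) hdec)).
rewrite lc in h1 h3.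
have ki := idx_ge eta0 idxP k (ltW tau0).
have Si : series eta (idx (series eta k + tau)) <= series eta k + tau.
  have Sk0 : 0 <= series eta k + tau by rewrite addr_ge0 ?(ltW tau0)// elapsed_ge0.
  by have /andP[] := idxP _ Sk0.
set i := idx (series eta k + tau) in ki h3 Si.
(* At time tau the value is below c: impossible at k itself, where it is close to c, and during the
   excursion, where it exceeds c. If the excursion is already over, it reached b too quickly. *)
have [im|im] := leqP i m.
  have [ik|ik] := eqVneq i k.
    by move: h1; rewrite -ik ltr_norml => /andP[]; lra.
  have := hi i; rewrite im ltn_neqAle eq_sym ik ki => /(_ isT); lra.
have := NP k m Nk (ltnW km).
have Smi := elapsed_nd eta0 (ltnW im).
have hS : series eta m - series eta k <= t1 by lra.
by move=> /(_ hS); rewrite ltr_norml => /andP[]; lra.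
Qed.

Lemma limit_point_stationary xs ys : cvg ((fun k => lyap (z k)) @ \oo) ->
  seq_limit_point z (col_mx xs ys) -> stationary D G H xs ys.
Proof.
move=> /cvg_ex[l lP] hlp; apply: contrapT => ns0.
set zs := col_mx xs ys in hlp.
have ns : ~ stationary D G H (usubmx zs) (dsubmx zs) by rewrite col_mxKu col_mxKd.
have [idx idxP] := idx_exists.
have [U UU UK] : exists2 U : set_system nat, UltraFilter U &
    forall N, U [set k | (N <= k)%N /\ enorm (z k - zs) < N.+1%:R^-1].
  apply: (@ultra_from (fun N => [set k | (N <= k)%N /\ enorm (z k - zs) < N.+1%:R^-1])).
    move=> N; have N0 : 0 < N.+1%:R^-1 :> R by rewrite invr_gt0.
    by have [k Nk hk] := hlp _ N0 N; exists k.
  move=> i j ij k /= [jk hk]; split; first exact: leq_trans jk.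
  by apply: (lt_le_trans hk); rewrite lef_pV2 ?posrE// ler_nat.
have Uoo N : U [set k | (N <= k)%N] by apply: filterS (UK N) => k [].
have zzs : ulim U z zs.
  move=> e e0; have [k /= hk] := filter_ex (inv_nat_small UU Uoo e0).
  by apply: filterS (UK k) => i /= [_ hi]; exact: lt_trans hi hk.
have [c0 c00 [t0 t00 dec]] := local_decrease UU Uoo idxP zzs ns.
have tc0 : 0 < t0 * c0 by rewrite mulr_gt0.
(* Three errors of a quarter, two from the limit of the values and one from the limit point, stay
   below the drop t0 c0. *)
have tc1 : 0 < t0 * c0 / 4 by rewrite divr_gt0.
have /cvgrPdist_lt/(_ _ tc1)[N _ NP] := lP.
have hdec := dec t0; rewrite t00 lexx in hdec; have {}hdec := hdec isT.
have [k /= [[h1 Nk] h2]] := filter_ex (filterI (filterI (lyap_ulim UU zzs tc1) (Uoo N)) hdec).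
have := NP k Nk; have := NP _ (leq_trans Nk (idx_ge eta0 idxP k (ltW t00))).
move: h1; rewrite /= !ltr_norml => /andP[a1 a2] /andP[b1 b2] /andP[d1 d2]; lra.
Qed.

End Bilevel.

Theorem theorem4p3 (R : realType) (n p : nat)
  (f g : 'cV[R]_(n + p) -> R)
  (G : 'cV[R]_(n + p) -> 'cV[R]_(n + p)) (H : 'cV[R]_(n + p) -> 'M[R]_(n + p))
  (D : 'cV[R]_(n + p) -> set 'cV[R]_(n + p))
  (Mf mu Lg Qg beta betahat : R)
  (* (A1) *)
  (hMf : 0 < Mf) (hmu : 0 < mu) (hLg : 0 < Lg) (hQg : 0 < Qg)
  (f_lip : forall z z', `|f z - f z'| <= Mf * enorm (z - z'))
  (g_grad : has_grad g G) (g_hess : has_jac G H)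
  (g_strong : forall z (u : 'cV[R]_p),
     mu * enorm u ^+ 2 <= dot u (hessyy H z *m u))
  (G_lip : forall z z', enorm (G z - G z') <= Lg * enorm (z - z'))
  (Hyy_lip : forall z z', opnorm (hessyy H z - hessyy H z') <= Qg * enorm (z - z'))
  (Hxy_lip : forall z z', opnorm (hessxy H z - hessxy H z') <= Qg * enorm (z - z'))
  (Hyy_C1 : forall i j : 'I_p, exists T : 'cV[R]_(n + p) -> 'cV[R]_(n + p),
     has_grad (fun z => hessyy H z i j) T /\ continuous T)
  (* (A2) *)
  (D_cons : conservative_field D)
  (D_convex : forall z, convex_vset (D z))
  (D_bound : forall z v, D z v -> enorm v <= Mf)
  (f_pot : potential_of f D)
  (* parameters *)
  (hbeta : 4 * Qg * Mf / mu ^+ 3 <= beta)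
  (hbetahat : beta * Num.max (8 * Lg ^+ 2 / mu) (Num.max (1 / (4 * mu)) (mu / 4))
                <= betahat)
  (* Algorithm 2 *)
  (x : nat -> 'cV[R]_n) (y w v : nat -> 'cV[R]_p)
  (dx : nat -> 'cV[R]_n) (dy : nat -> 'cV[R]_p) (eta eps1 eps2 : nat -> R)
  (hw : forall k, enorm (hessyy H (col_mx (x k) (y k)) *m w k
                          - grady G (col_mx (x k) (y k))) <= eps1 k)
  (hd : forall k, D (col_mx (x k) (y k - w k)) (col_mx (dx k) (dy k)))
  (hv : forall k, enorm (hessyy H (col_mx (x k) (y k)) *m v k - dy k) <= eps2 k)
  (hx : forall k, x k.+1 =
         x k - eta k *: (dx k - hessxy H (col_mx (x k) (y k)) *m v k))
  (hy : forall k, y k.+1 = y k - (eta k * betahat) *: grady G (col_mx (x k) (y k)))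
  (* (a) *)
  (ha : exists B : R, forall k, enorm (x k) + enorm (y k) <= B)
  (* (b) *)
  (heta0 : forall k, 0 <= eta k)
  (heta_div : series eta @ \oo --> +oo)
  (heta_sq : cvg (series (fun k => eta k ^+ 2) @ \oo))
  (* (c) *)
  (hc : interior [set r : R | exists (xs : 'cV[R]_n) (ys : 'cV[R]_p),
                         stationary D G H xs ys /\ r = f (col_mx xs ys)]
          = set0)
  (heps1 : eps1 @ \oo --> 0)
  (heps2 : cvg (series (fun k => eps2 k * eta k) @ \oo)) :
  (forall (xs : 'cV[R]_n) (ys : 'cV[R]_p),
     (seq_limit_point (fun k => col_mx (x k) (y k)) (col_mx xs ys)) ->
     stationary D G H xs ys)
  /\ cvg ((fun k : nat => hfun f beta G H (x k) (y k)) @ \oo).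
Proof.
have [D_closed _] := D_cons.
have beta0 := beta_gt0 hMf hmu hQg hbeta.
have hbetahat' : beta * (8 * Lg ^+ 2 / mu) <= betahat.
  apply: le_trans hbetahat; rewrite ler_wpM2l ?(ltW beta0)//.
  by rewrite le_max lexx.
have [B hB] := ha.
have zB k : enorm (col_mx (x k) (y k)) <= B by exact: le_trans (enorm_col_mx _ _) (hB k).
have hE : (fun k => hfun f beta G H (x k) (y k)) =
    (fun k => f (newton_pt G H (col_mx (x k) (y k))) + penalty G beta (col_mx (x k) (y k))).
  by apply/funext => k; rewrite hfunE.
have cv := lyap_cvg hMf hmu hLg hQg f_lip g_grad g_hess g_strong G_lip Hyy_lip Hxy_lip
  hbeta hbetahat' D_closed D_convex D_bound f_pot hw hd hv hx hy zB heta0 heta_div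
  heta_sq heps1 heps2 hc.
split; last by rewrite hE.
move=> xs ys; exact: (limit_point_stationary hMf hmu hLg hQg f_lip g_grad g_hess g_strong
  G_lip Hyy_lip Hxy_lip hbeta hbetahat' D_closed D_convex D_bound f_pot hw hd hv hx hy zB
  heta0 heta_div heta_sq heps1 heps2 cv).
Qed.
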